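(* Let $\eta$ be an $\mathbb{N}$-valued random variable with $\mathbf{P}[\eta\ge1]>0$ and $\mathbf{E}\,\eta<\infty$. Then \[ \lim_{d\to\infty}p_c(\mathbb{T}_d,\eta)=\frac{1}{1+\mathbf{E}\,\eta}. \]
   Context: Here $\mathbb{N}=\{0,1,2,\dots\}$, and $\mathbb{T}_d$ ($d\ge 3$) denotes the infinite homogeneous tree in which every vertex has degree $d$, with a fixed root $\mathbf{0}$. Frog model $\mathrm{FM}(\mathcal{G},p,\eta)$. Let $\mathcal{G}$ be an infinite connected undirected graph all of whose sites (vertices) have finite degree, with a fixed site $\mathbf{0}$ called the root; let $p\in[0,1]$ and let $\eta$ be a random variable with values in $\mathbb{N}$. Let $\{\eta(x)\}_{x}$, $\{(S^x_n(i))_{n\in\mathbb{N}}\}_{x,\,i\ge1}$, $\{\Xi^x_p(i)\}_{x,\,i\ge 1}$ be independent families of independent random variables, where $\eta(x)$ has the law of $\eta$, $(S^x_n(i))_n$ is a discrete-time simple random walk on $\mathcal{G}$ started from $x$, and $\mathbf{P}[\Xi^x_p(i)=k]=(1-p)p^{k-1}$, $k=1,2,\dots$ (for $p=1$, $\Xi^x_p(i)=\infty$, no death). Site $x$ initially contains $\eta(x)$ particles; at time $0$ all particles are sleeping except those at the root, which are active. If the particles of site $x$ are activated at time $T(x)$, the $i$-th of them ($1\le i\le\eta(x)$) is active and located at $S^x_n(i)$ at time $T(x)+n$ for $0\le n<\Xi^x_p(i)$, and then disappears. When an active particle visits a site, all sleeping particles there become active. Formally, $t(x,y)=\min_{1\le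 i\le\eta(x)}\min\{n<\Xi^x_p(i):S^x_n(i)=y\}$ for $x\ne y$ ($\infty$ if there is no such $n$), and $T(x)=\inf\{t(x_0,x_1)+\dots+t(x_{m-1},x_m)\}$ over all finite sequences $\mathbf{0}=x_0,x_1,\dots,x_m=x$, with $T(\mathbf{0})=0$; $T(x)=\infty$ means that $x$ is never visited by active particles. The model survives if at every time there is at least one active particle; otherwise it dies out. The critical parameter is $p_c(\mathcal{G},\eta)=\inf\{p\in[0,1]:\mathbf{P}[\mathrm{FM}(\mathcal{G},p,\eta)\text{ survives}]>0\}$. *)

(* Defs.v *)
From HB Require Import structures.
From mathcomp Require Import all_boot all_order all_algebra.
From mathcomp Require Import all_classical all_reals all_analysis.

Set Implicit Arguments.
Unset Strict Implicit.
Unset Printing Implicit Defensive.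

Import Order.TTheory GRing.Theory Num.Theory.
Import numFieldNormedType.Exports.

Local Open Scope classical_set_scope.
Local Open Scope ring_scope.

(* Connected simple graphs with finite degrees and a root. Such a graph has
   countably many vertices, so a countType loses no generality. *)
Record rooted_graph := RootedGraph {
  vertex :> countType;
  nbrs : vertex -> seq vertex;
  root : vertex;
  nbrs_uniq : forall x, uniq (nbrs x);
  nbrs_irrefl : forall x, x \notin nbrs x;
  nbrs_sym : forall x y, (y \in nbrs x) = (x \in nbrs y);
  nbrs_connected : forall x,
    exists s, path (fun y z => z \in nbrs y) root s /\ last root s = x
}.
Arguments root {_}.

(* The d-regular tree is realized as the Cayley graph of the free product of
   d copies of Z/2: vertices are the words over 'I_d without two equal
   consecutive letters, and the neighbour of a vertex along the edge labelled i
   is obtained by multiplying by the involution i on the left. *)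
Section RegularTree.
Variable d : nat.

Definition reduced (s : seq 'I_d) := sorted (fun i j => i != j) s.

Definition word := {s : seq 'I_d | reduced s}.

Definition toggle_seq (i : 'I_d) (s : seq 'I_d) : seq 'I_d :=
  if s is j :: s' then if i == j then s' else i :: s else [:: i].

Lemma toggle_reduced i s : reduced s -> reduced (toggle_seq i s).
Proof.
case: s => [//|j s] /=; case: eqVneq => [_|ij] js; last by rewrite /= ij.
exact: path_sorted js.
Qed.

Definition toggle (i : 'I_d) (x : word) : word :=
  exist _ (toggle_seq i (sval x)) (toggle_reduced i (svalP x)).

Definition empty_word : word := exist _ [::] isT.

Definition tree_nbrs (x : word) : seq word := [seq toggle i x | i <- enum 'I_d].

Lemma toggleK i : involutive (toggle i).
Proof.
move=> [s rs]; apply: val_inj => /=; case: s rs => [|j s] /=.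
  by rewrite eqxx.
case: eqVneq => [->|ij] rs; last by rewrite /= eqxx.
by case: s rs => [//|k s] /= /andP[/negPf ->].
Qed.

Lemma toggle_injl x : injective (toggle^~ x).
Proof.
move=> i j /(congr1 val) /=; case: (sval x) => [|k s] /=; first by case.
case: eqVneq => [->|ik]; case: eqVneq => [->//|jk] //=; last by case.
  by move=> /(congr1 size) /= /eqP; rewrite -addn2 -{1}[size s]addn0 eqn_add2l.
by move=> /(congr1 size) /= /eqP; rewrite eq_sym -addn2 -{1}[size s]addn0 eqn_add2l.
Qed.

Lemma size_toggle i x :
  size (sval (toggle i x)) = (size (sval x)).+1 \/
  (size (sval (toggle i x))).+1 = size (sval x).
Proof.
case: x => [[|j s] rs] /=; first by left.
by case: eqVneq => _; [right | left].
Qed.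

Lemma tree_nbrsP x y : reflect (exists i, y = toggle i x) (y \in tree_nbrs x).
Proof.
apply: (iffP mapP) => [[i _ ->]|[i ->]]; first by exists i.
by exists i; rewrite ?mem_enum.
Qed.

Lemma tree_nbrs_uniq x : uniq (tree_nbrs x).
Proof. by rewrite map_inj_uniq ?enum_uniq//; exact: toggle_injl. Qed.

Lemma tree_nbrs_irrefl x : x \notin tree_nbrs x.
Proof.
apply/negP => /tree_nbrsP[i xi].
by case: (size_toggle i x); rewrite -xi => /eqP; rewrite ?(ltn_eqF (ltnSn _)) // eq_sym (ltn_eqF (ltnSn _)).
Qed.

Lemma tree_nbrs_sym x y : (y \in tree_nbrs x) = (x \in tree_nbrs y).
Proof.
by apply/tree_nbrsP/tree_nbrsP => -[i ->]; exists i; rewrite toggleK.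
Qed.

Lemma tree_nbrs_connected x :
  exists s, path (fun y z => z \in tree_nbrs y) empty_word s /\
            last empty_word s = x.
Proof.
case: x => s; elim: s => [|i s IH] rs.
  by exists [::]; split=> //; apply: val_inj.
have [t [pt lt]] := IH (path_sorted rs).
exists (rcons t (exist _ (i :: s) rs)); rewrite rcons_path last_rcons pt lt.
split=> //; apply/tree_nbrsP; exists i; apply: val_inj => /=.
by case: s rs {IH pt lt} => [//|j s] /= /andP[/negPf ->].
Qed.

Definition regular_tree : rooted_graph :=
  @RootedGraph word tree_nbrs empty_word tree_nbrs_uniq tree_nbrs_irrefl tree_nbrs_sym
              tree_nbrs_connected.

Lemma regular_tree_degree (x : regular_tree) : size (nbrs x) = d.
Proof. by rewrite size_map size_enum_ord. Qed.

Lemma shorter_nbr (x y z : word) : y \in tree_nbrs x -> z \in tree_nbrs x ->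
  (size (sval y) <= size (sval x))%N -> (size (sval z) <= size (sval x))%N ->
  y = z.
Proof.
case: x => [[|k s] rs] /tree_nbrsP[i ->] /tree_nbrsP[j ->] //=.
case: eqVneq => [-> _|_]; last by rewrite ltnn.
by case: eqVneq => [->|_] //; rewrite ltnn.
Qed.

Lemma regular_tree_acyclic (c : seq regular_tree) :
  (2 < size c)%N -> ~~ (cycle (fun x y => y \in nbrs x) c && uniq c).
Proof.
move=> c3; apply/negP => /andP[cc uc].
have [x xc xmax] : exists2 x, x \in c &
    forall y, y \in c -> (size (sval y) <= size (sval x))%N.
  case: c c3 {cc uc} => [//|a c] _.
  elim: c a => [|b c IH] a.
    by exists a; rewrite ?mem_head// => y; rewrite inE => /eqP ->.
  have [x xc xmax] := IH b.
  case: (leqP (size (sval a)) (size (sval x))) => ax.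
    exists x; first by rewrite inE xc orbT.
    by move=> y; rewrite inE => /predU1P[->//|/xmax].
  exists a; first exact: mem_head.
  move=> y; rewrite inE => /predU1P[->//|/xmax yx].
  exact: leq_trans yx (ltnW ax).
have [i s rotc] := rot_to xc.
move: cc uc c3; rewrite -(rot_cycle i) -(rot_uniq i c) -(size_rot i c) rotc.
have {}xmax y : y \in s -> (size (sval y) <= size (sval x))%N.
  by move=> ys; apply: xmax; rewrite -(mem_rot i) rotc inE ys orbT.
case: s xmax {rotc} => [//|y s] xmax /=.
rewrite rcons_path => /andP[xy /andP[_ zx]] /and3P[_ ys us].
case/lastP: s xmax zx ys us => [//|s z] xmax.
rewrite last_rcons => zx ys _ _; move: ys; rewrite mem_rcons inE => /norP[/eqP[]].
apply: (@shorter_nbr x) => //; first by rewrite tree_nbrs_sym.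
  by apply: xmax; rewrite mem_head.
by apply: xmax; rewrite inE mem_rcons mem_head orbT.
Qed.

Lemma regular_tree_infinite : (1 < d)%N -> infinite_set [set: regular_tree].
Proof.
move=> d1.
have wordS n : exists x : word, size (sval x) = n.
  elim: n => [|n [x xn]]; first by exists empty_word.
  have d0 : (0 < d)%N by exact: ltnW.
  have [e|e] := size_toggle (Ordinal d0) x; first
    by exists (toggle (Ordinal d0) x); rewrite e xn.
  exists (toggle (Ordinal d1) x).
  case: x e {xn} (xn) => [[|k s] rs] /=; first by [].
  case: eqVneq => [<-|_] /=; first by move=> _ <-.
  by move=> /eqP; rewrite gtn_eqF.
move=> fin; apply: infinite_nat.
rewrite -[X in finite_set X](_ : (fun x : word => size (sval x)) @` setT = _).
  exact: finite_image fin.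
apply/seteqP; split=> // n _; have [x xn] := wordS n; by exists x.
Qed.

End RegularTree.

Section FrogModel.
Variable R : realType.

(* Transition probabilities of the simple random walk on G *)
Definition srw_step (G : rooted_graph) (x y : G) : R :=
  (y \in nbrs x)%:R / (size (nbrs x))%:R.

(* Law of the lifetime of a particle, None standing for an infinite lifetime *)
Definition lifetime_pmf (p : R) (k : option nat) : R :=
  match k with
  | Some 0%N => 0
  | Some k'.+1 => (1 - p) * p ^+ k'
  | None => (p == 1)%:R
  end.

Definition alive (l : option nat) (n : nat) : bool :=
  if l is Some k then (n < k)%N else true.

(* Mutual independence of a family of sigma-algebras *)
Definition mutually_independent d (T : measurableType d)
    (P : probability T R) (J : eqType) (F : J -> set_system T) :=
  forall (s : seq J) (A : J -> set T), uniq s ->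
    (forall j, j \in s -> F j (A j)) ->
    P (\big[setI/setT]_(j <- s) A j) = (\prod_(j <- s) P (A j))%E.

(* A realization of FM(G, p, eta): a probability space carrying the families
   eta(x), S^x(i) and Xi_p^x(i). The particles of a site are numbered from 0.
   For maps into the countable types G and option nat, measurability of the
   fibers is measurability for the discrete sigma-algebra. The index types G,
   G * nat and G * nat of the three families are summed in order to state that
   all these random elements are jointly independent. *)
Record frog_model (G : rooted_graph) (p : R) d0 (T0 : measurableType d0)
    (P0 : probability T0 R) (eta : {RV P0 >-> nat}) := FrogModel {
  fm_display : measure_display;
  fm_space : measurableType fm_display;
  fm_prob : probability fm_space R;
  fm_eta : G -> {RV fm_prob >-> nat};
  fm_walk : G -> nat -> nat -> fm_space -> G;
  fm_life : G -> nat -> fm_space -> option nat;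
  fm_eta_law : forall x k,
    fm_prob (fm_eta x @^-1` [set k]) = P0 (eta @^-1` [set k]);
  fm_walk_measurable : forall x i n y,
    measurable (fm_walk x i n @^-1` [set y]);
  fm_walk_law : forall x i n (y : nat -> G),
    fm_prob [set w | forall k, (k <= n)%N -> fm_walk x i k w = y k] =
    ((y 0%N == x)%:R * \prod_(k < n) srw_step (y k) (y k.+1))%:E;
  fm_life_measurable : forall x i k,
    measurable (fm_life x i @^-1` [set k]);
  fm_life_law : forall x i k,
    fm_prob (fm_life x i @^-1` [set k]) = (lifetime_pmf p k)%:E;
  fm_independent : mutually_independent fm_prob
    (fun j : G + (G * nat + G * nat) =>
       match j with
       | inl x => <<s [set A | exists k, A = fm_eta x @^-1` [set k]] >>
       | inr (inl (x, i)) =>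
           <<s [set A | exists n y, A = fm_walk x i n @^-1` [set y]] >>
       | inr (inr (x, i)) =>
           <<s [set A | exists k, A = fm_life x i @^-1` [set k]] >>
       end)
}.

Arguments fm_eta {G p d0 T0 P0 eta}.
Arguments fm_walk {G p d0 T0 P0 eta}.
Arguments fm_life {G p d0 T0 P0 eta}.

Section Dynamics.
Variables (G : rooted_graph) (p : R) (d0 : measure_display).
Variables (T0 : measurableType d0) (P0 : probability T0 R).
Variables (eta : {RV P0 >-> nat}) (M : frog_model G p eta).
Implicit Types (w : fm_space M) (x y : G) (n : nat).

(* The time t(x, y) *)
Definition passage_time w x y : \bar R :=
  ereal_inf [set n%:R%:E | n in [set n | exists i,
    [/\ (i < fm_eta M x w)%N, alive (fm_life M x i w) n &
        fm_walk M x i n w = y]]].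

Fixpoint route_time w x (s : seq G) : \bar R :=
  if s is y :: s' then (passage_time w x y + route_time w y s')%E else 0%E.

(* The time T(x); the route [::] gives T(root) = 0 *)
Definition activation_time w x : \bar R :=
  ereal_inf [set route_time w root s | s in [set s |
    path (fun y z => y != z) root s /\ last root s = x]].

Definition particle_active w n x i : Prop :=
  (i < fm_eta M x w)%N /\
  exists2 m, alive (fm_life M x i w) m &
    (activation_time w x + m%:R%:E = n%:R%:E)%E.

Definition survival : set (fm_space M) :=
  [set w | forall n, exists x i, particle_active w n x i].

End Dynamics.
Arguments survival {G p d0 T0 P0 eta}.

(* The law of a realization is determined by G, p and the law of eta, so the
   probability of survival does not depend on the realization M. *)
Definition p_c (G : rooted_graph) d0 (T0 : measurableType d0)
    (P0 : probability T0 R) (eta : {RV P0 >-> nat}) : R :=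
  inf [set p : R | 0 <= p <= 1 /\
    exists M : frog_model G p eta, (0 < fm_prob M (survival M))%E].

End FrogModel.

(* Main.v *)
(* Lower bound. If a particle is active at time n, then the particles used along
   an optimal route form a chain of jumps of total duration n from the root.
   Activation times increase along the route, so its sites are distinct and the
   chain involves independent families; the expected number of such chains is
   at most (E eta) (p (1 + E eta)) ^ n, which tends to 0 when
   p (1 + E eta) < 1. This holds on every graph.

   Upper bound. Let p (1 + E eta) > 1. Keep only the first K particles of every
   site and only their first L jumps, and explore the tree away from the root: a
   site is explored when the K (L + 1) labels of the edges crossed by its
   particles are distinct, differ from the edge towards the root and from one
   forbidden edge. Its particles then visit disjoint rays; the site y reached on
   a ray is explored in turn, its forbidden edge being the next edge of the ray.
   The explorations of the sites of the rays take place in disjoint subtrees,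
   hence are independent, and the mean number of sites reached is
   E (min eta K) (p + ... + p ^ L) (1 - O(1/d)) > 1 for K, L and d large. As for
   a supercritical branching process, n generations are explored with a
   probability bounded below uniformly in n. *)
From HB Require Import structures.
Require Import Defs.
From mathcomp Require Import all_boot all_order all_algebra.
From mathcomp Require Import all_classical all_reals all_analysis.
From mathcomp Require Import ring lra.

Set Implicit Arguments.
Unset Strict Implicit.
Unset Printing Implicit Defensive.

Import Order.TTheory GRing.Theory Num.Theory.
Import numFieldNormedType.Exports.

Local Open Scope classical_set_scope.
Local Open Scope ring_scope.

(** * Measurability and independence *)

(** The two halves treat realizations differently. [p_c] asks for some surviving realization, so the
    lower bound must rule out survival in an arbitrary one, while the upper bound has to build one.
    In an arbitrary realization the labels of the crossed edges would have to be recovered from the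
    law of the paths; building the walks from independent uniform labels gives their independence at
    once. All these variables are read off one uniform number as its digits.

    The forbidden edge makes all sites of one ray usable together: the subtree of a site, cut at the
    next edge of its ray, contains no later site of that ray. The comparison with branching is then
    a fixed-point argument. If n generations are explored from every site with probability at least
    e, then n+1 generations are with probability at least (1 - C/(d+1)) (e mu - (K L e)^2), where C
    depends only on K and L, and mu is the mean number of particle positions kept. Since mu > 1,
    this is at least e for a small e fixed before d. Exploring n generations reaches depth n, which
    takes time at least n. *)

Section Measurability.
Context d (T : measurableType d).

Lemma measurable_ex (I : countType) (F : I -> T -> Prop) :
  (forall i, measurable [set w | F i w]) -> measurable [set w | exists i, F i w].
Proof.
move=> mF; rewrite [X in measurable X](_ : _ = \bigcup_i [set w | F i w]).
  exact: countable_bigcupT_measurable (countableP _) mF.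
by apply/seteqP; split=> w /= [i]; [exists i | move=> _; exists i].
Qed.

Lemma measurable_all (I : countType) (F : I -> T -> Prop) :
  (forall i, measurable [set w | F i w]) ->
  measurable [set w | forall i, F i w].
Proof.
move=> mF; rewrite -[X in measurable X]setCK; apply: measurableC.
rewrite [X in measurable X](_ : _ = [set w | exists i, ~ F i w]).
  by apply: measurable_ex => i; exact/measurableC/mF.
by apply/seteqP; split=> w /=; [move/existsNP | case=> i ni h; exact: ni].
Qed.

Lemma measurable_and2 (A B : T -> Prop) : measurable [set w | A w] ->
  measurable [set w | B w] -> measurable [set w | A w /\ B w].
Proof. exact: measurableI. Qed.

Lemma measurable_prop (A : Prop) : measurable [set _ : T | A].
Proof.
have [a|a] := pselect A.
  by rewrite [X in measurable X](_ : _ = setT) //; apply/seteqP; split.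
by rewrite [X in measurable X](_ : _ = set0) //; apply/seteqP; split.
Qed.

End Measurability.

Section Independence.
Variable R : realType.
Context d (T : measurableType d) (P : probability T R).
Local Open Scope ereal_scope.

(** Subadditivity handles the union of the [F i], which may overlap, and disjointness of the [G i]
    turns the resulting sum back into one probability. In the first-moment bound, [i] is the site
    where a particle lands. *)
Lemma countable_union_bound (I : countType) (F G : I -> set T) (c : R) :
  (0 <= c)%R -> (forall i, measurable (F i)) -> (forall i, measurable (G i)) ->
  trivIset setT G -> (forall i, P (F i) <= P (G i) * c%:E) ->
  P (\bigcup_i F i) <= P (\bigcup_i G i) * c%:E.
Proof.
move=> c0 mF mG tG FG.
pose ext (H : I -> set T) n := if unpickle n is Some i then
  if pickle i == n then H i else set0 else set0.
have extE H : \bigcup_i H i = \bigcup_n ext H n.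
  apply/seteqP; split=> w [i _ Hi].
    by exists (pickle i) => //; rewrite /ext pickleK eqxx.
  move: Hi; rewrite /ext; case: (unpickle i) => [j|//].
  by case: ifP => // _ Hj; exists j.
have mext H : (forall i, measurable (H i)) -> forall n, measurable (ext H n).
  by move=> mH n; rewrite /ext; case: unpickle => // i; case: ifP.
rewrite !extE.
have mU : measurable (\bigcup_n ext F n).
  by apply: bigcup_measurable => n _; exact: mext.
have := @measure_sigma_subadditive _ _ _ P _ _ (mext F mF) mU (@subset_refl _ _).
move/le_trans; apply.
rewrite (@measure_semi_bigcup _ _ _ P (ext G)) //; last first.
- by apply: bigcup_measurable => n _; exact: mext.
- move=> m n _ _ [w []]; rewrite /ext.
  case um: (unpickle m) => [i|//]; case: eqP => // im.
  case un: (unpickle n) => [j|//]; case: eqP => // jn Gi Gj.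
  by rewrite -im -jn (tG i j) //; exists w.
- exact: mext.
rewrite muleC.
rewrite -nneseriesZl; last by [].

apply: lee_nneseries => // n _ ; rewrite /ext.
case: unpickle => [i|]; last by rewrite measure0 mule0.
by case: ifP => _; [rewrite muleC; exact: FG | rewrite measure0 mule0].
Qed.

Lemma countable_union0 (I : countType) (F : I -> set T) :
  (forall i, measurable (F i)) -> (forall i, P (F i) = 0) ->
  P (\bigcup_i F i) = 0.
Proof.
move=> mF F0; apply/eqP; rewrite eq_le measure_ge0 andbT.
apply: le_trans (@countable_union_bound _ F (fun=> set0) 0 _ _ _ _ _) _ => //.
- by move=> i j _ _ [w []].
- by move=> i; rewrite F0 mule0.
- by rewrite mule0.
Qed.

Lemma measure_bigcup_nat_le (F : nat -> set T) : (forall n, measurable (F n)) ->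
  P (\bigcup_n F n) <= \sum_(0 <= n <oo) P (F n).
Proof.
move=> mF; apply: (@measure_sigma_subadditive _ _ _ P _ _ mF _ (@subset_refl _ _)).
exact: bigcup_measurable.
Qed.

Lemma law_eq d' (T' : measurableType d') (Q : probability T' R)
    (X : {RV P >-> nat}) (Y : {RV Q >-> nat}) (A : set nat) :
  (forall k, P (X @^-1` [set k]) = Q (Y @^-1` [set k])) ->
  P (X @^-1` A) = Q (Y @^-1` A).
Proof.
move=> XY; have decomp (S : Type) (Z : S -> nat) : Z @^-1` A =
    \bigcup_k (Z @^-1` [set k] `&` [set _ | A k]).
  apply/seteqP; split=> w /=; first by exists (Z w).
  by move=> [k _ [/= ->]].
have tr (S : Type) (Z : S -> nat) :
    trivIset setT (fun k => Z @^-1` [set k] `&` [set _ | A k]).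
  by move=> k l _ _ [w [[<- _] [<- _]]].
have m d1 (S : measurableType d1) (O : probability S R) (Z : {RV O >-> nat}) k :
    measurable (Z @^-1` [set k] `&` [set _ | A k]).
  apply: measurableI; last exact: measurable_prop.
  rewrite -[X in measurable X]setTI; exact: (measurable_funPT Z).
rewrite !decomp !measure_semi_bigcup //; try exact: bigcup_measurable.
apply: eq_eseriesr => k _; have [Ak|Ak] := pselect (A k).
  have eT (S : Type) : [set _ : S | A k] = setT by apply/seteqP; split.
  rewrite !eT !setIT; exact: XY.
have e0 (S : Type) : [set _ : S | A k] = set0 by apply/seteqP; split.
by rewrite !e0 !setI0 !measure0.
Qed.

(** [X] is the sum of the indicators of [i < X]; for [eta], the term of index [i] is the chance that
    particle [i] exists. *)
Lemma expectation_nat (X : {RV P >-> nat}) :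
  'E_P[fun w => (X w)%:R : R] = \sum_(0 <= i <oo) P [set w | (i < X w)%N].
Proof.
have mX i : measurable [set w | (i < X w)%N].
  rewrite -[X in measurable X]setTI.
  exact: (measurable_funPT X measurableT [set k | (i < k)%N]).
rewrite unlock; transitivity (\int[P]_w \sum_(0 <= i <oo) (\1_[set w | (i < X w)%N] w)%:E).
  apply: eq_integral => w _.
  rewrite (nneseries_split _ (X w)) //.
  rewrite eseries0 ?adde0; last first.
    by move=> i Xi _; rewrite indicE /= memNset //= ltnNge Xi.
  rewrite add0n sumEFin (eq_big_nat _ _ (F2 := fun=> 1%R)).
    by rewrite sumr_const_nat subn0.
  by move=> i /= iX; rewrite indicE mem_set.
rewrite integral_nneseries //.
- by apply: eq_eseriesr => i _; rewrite integral_indic // setIT.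
- by move=> i; apply/measurable_realfun.measurable_EFinP; exact: measurable_realfun.measurable_indic.
Qed.

Definition pr (A : set T) : R := fine (P A).

Lemma prE A : measurable A -> P A = (pr A)%:E.
Proof. by move=> mA; rewrite /pr fineK // fin_num_measure. Qed.

Lemma pr_ge0 A : (0 <= pr A)%R.
Proof. exact: fine_ge0. Qed.

Lemma le_pr A B : measurable A -> measurable B -> A `<=` B -> (pr A <= pr B)%R.
Proof.
by move=> mA mB AB; rewrite -lee_fin -!prE // le_measure // inE.
Qed.

Lemma prT : pr setT = 1%R.
Proof. by rewrite /pr probability_setT. Qed.

Lemma pr0 : pr set0 = 0%R.
Proof. by rewrite /pr measure0. Qed.

Lemma prC A : measurable A -> pr (~` A) = (1 - pr A)%R.
Proof.
move=> mA; apply: EFin_inj; rewrite -prE; last exact: measurableC.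
by rewrite probability_setC // prE.
Qed.

Lemma prU_le A B : measurable A -> measurable B ->
  (pr (A `|` B) <= pr A + pr B)%R.
Proof.
move=> mA mB; rewrite -lee_fin EFinD -!prE //; last exact: measurableU.
exact: measureU2.
Qed.

Lemma pr_bigU_le (I : Type) (s : seq I) (A : I -> set T) :
  (forall i, measurable (A i)) ->
  (pr (\big[setU/set0]_(i <- s) A i) <= \sum_(i <- s) pr (A i))%R.
Proof.
move=> mA; elim: s => [|i s IH]; first by rewrite !big_nil pr0.
rewrite !big_cons; apply: le_trans (prU_le _ _) _ => //.
  exact: bigsetU_measurable.
by rewrite lerD2l.
Qed.

Lemma pr_total (V : finType) (X : T -> V) (A : set T) :
  (forall v, measurable (X @^-1` [set v])) -> measurable A ->
  pr A = (\sum_v pr (X @^-1` [set v] `&` A))%R.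
Proof.
move=> mX mA.
have -> : A = \bigcup_(v in [set` index_enum V]) (X @^-1` [set v] `&` A).
  apply/seteqP; split=> [w Aw|w [v _ []]//].
  by exists (X w) => //=; rewrite mem_index_enum.
have mXA v : measurable (X @^-1` [set v] `&` A) by exact: measurableI.
apply: EFin_inj; rewrite -prE; last exact: fin_bigcup_measurable.
rewrite measure_fin_bigcup //; last by move=> u v _ _ [w [[<- _] [<- _]]].
rewrite -fsbig_seq ?index_enum_uniq // -sumEFin.
apply: eq_bigr => v _; rewrite -prE; last first.
  by apply: measurableI => //; exact: fin_bigcup_measurable.
congr (P _); apply/seteqP; split=> [w [vw Aw]|w [vw [u _ [_ Aw]]]] //.
by split=> //; exists v => //=; rewrite mem_index_enum.
Qed.

(** Dynkin's argument: the events independent of [F] form a Dynkin system, so it suffices that they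
    contain the pi-system [G]. *)
Lemma indep_g_sigma (G : set_system T) F : setI_closed G ->
  G `<=` measurable -> measurable F ->
  (forall E, G E -> P (E `&` F) = P E * P F) ->
  forall E, <<s G>> E -> P (E `&` F) = P E * P F.
Proof.
move=> IG mG mF GF.
suff : <<s G>> `<=` [set E | measurable E /\ P (E `&` F) = P E * P F].
  by move=> sub E /sub[].
rewrite -setI_closed_g_dynkin_g_sigma_algebra //.
apply: smallest_sub; last by move=> E GE; split; [exact: mG | exact: GF].
split=> [|E [mE EF]|E tE EF].
- by split=> //; rewrite setTI probability_setT mul1e.
- split; first exact: measurableC.
  rewrite probability_setC // (prE mE) (prE mF).
  have -> : ~` E `&` F = F `\` (E `&` F).
    apply/seteqP; split=> [w [nE Fw]|w [Fw nEF]]; first by split=> // -[].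
    by split=> // Ew; apply: nEF.
  rewrite measureD //; last 2 first.
  + exact: measurableI.
  + by rewrite -ge0_fin_numE ?fin_num_measure.
  rewrite setICA setIid [X in _ - X](_ : _ = P E * P F) //.
  rewrite [X in X - _](_ : _ = (pr F)%:E); last exact: prE.
  rewrite (prE mE) (prE mF) -EFinM -!EFinB.
  have -> : (pr F - pr E * pr F = (1 - pr E) * pr F)%R by rewrite mulrBl mul1r.
  exact: EFinM.
- have mE n : measurable (E n) by have [] := EF n.
  split; first exact: bigcup_measurable.
  rewrite setI_bigcupl !measure_semi_bigcup //.
  + rewrite (prE mF) muleC -nneseriesZl //.
    apply: eq_eseriesr => n _; have [_ EFn] := EF n.
    by rewrite muleC -(prE mF).
  + exact: bigcup_measurable.
  + by move=> n; exact: measurableI.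
  + by under eq_fun do rewrite setIC; exact: trivIset_setIl.
  + by apply: bigcup_measurable => n _; exact: measurableI.
Qed.

(** * Independence of disjoint groups of independent sigma-algebras *)

Section Blocks.
Variables (J : choiceType) (F : J -> set_system T).
Hypothesis mF : forall j, F j `<=` measurable.
Hypothesis FI : forall j, setI_closed (F j).
Hypothesis FT : forall j, F j setT.
Hypothesis indF : mutually_independent P F.

Definition sigma_block (W : set J) : set_system T :=
  <<s [set A | exists2 j, W j & F j A]>>.

(** Stable under intersection and generating [sigma_block W]: the pi-system to which Dynkin's
    argument applies. *)
Definition cylinder (W : set J) : set_system T :=
  [set A | exists s B, [/\ uniq s, forall j, j \in s -> W j /\ F j (B j) &
     A = \bigcap_(j in [set` s]) B j]].

Lemma sigma_block_measurable W : sigma_block W `<=` measurable.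
Proof.
apply: smallest_sub; first exact: sigma_algebra_measurable.
by move=> A [j _ /mF].
Qed.

Lemma cylinder_measurable W : cylinder W `<=` measurable.
Proof.
move=> A [s [B [_ WF ->]]].
by apply: fin_bigcap_measurable => // j /WF[_ /mF].
Qed.

Lemma cylinderI W1 W2 : forall A B, cylinder W1 A -> cylinder W2 B ->
  cylinder (W1 `|` W2) (A `&` B).
Proof.
move=> _ _ [s1 [B1 [u1 h1 ->]]] [s2 [B2 [u2 h2 ->]]].
(* An index absent from one of the two lists contributes [setT] on that side. *)
exists (undup (s1 ++ s2)), (fun j => (if j \in s1 then B1 j else setT) `&`
                              (if j \in s2 then B2 j else setT)).
split; first exact: undup_uniq.
  move=> j; rewrite mem_undup mem_cat => js; split.
    by case/orP: js => [/h1[]|/h2[]]; [left|right].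
  apply: FI; first by case: ifP => [/h1[]|_]; last exact: FT.
  by case: ifP => [/h2[]|_]; last exact: FT.
apply/seteqP; split=> [w [w1 w2] j _|w h].
  by split; case: ifP => // js; [exact: w1 | exact: w2].
split=> j /= js; have [] : ((if j \in s1 then B1 j else setT) `&`
                              (if j \in s2 then B2 j else setT)) w.
- by apply: h; rewrite /= mem_undup mem_cat js.
- by rewrite js.
- by apply: h; rewrite /= mem_undup mem_cat js orbT.
- by rewrite js.
Qed.

Lemma cylinder_indep W1 W2 A B : W1 `&` W2 = set0 ->
  cylinder W1 A -> cylinder W2 B -> P (A `&` B) = P A * P B.
Proof.
move=> W12 [s1 [B1 [u1 h1 ->]]] [s2 [B2 [u2 h2 ->]]].
pose C j := if j \in s1 then B1 j else B2 j.
have dis j : j \in s2 -> j \in s1 = false.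
  move=> js2; apply/negP => /h1[jW1 _].
  have [jW2 _] := h2 _ js2.
  by have : (W1 `&` W2) j by []; rewrite W12.
have E1 : \bigcap_(j in [set` s1]) B1 j = \big[setI/setT]_(j <- s1) C j.
  by rewrite -bigcap_seq; apply: eq_bigcapr => j /= js; rewrite /C js.
have E2 : \bigcap_(j in [set` s2]) B2 j = \big[setI/setT]_(j <- s2) C j.
  by rewrite -bigcap_seq; apply: eq_bigcapr => j /= js; rewrite /C dis.
have h j : (j \in s1) || (j \in s2) -> F j (C j).
  rewrite /C; case: ifP => [/h1[]//|_ /= /h2[]//].
have u12 : uniq (s1 ++ s2).
  rewrite cat_uniq u1 u2 andbT /= -all_predC; apply/allP => j js /=.
  by rewrite dis.
rewrite E1 E2 -big_cat !indF ?big_cat //=;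
  by move=> j js; apply: h; move: js; rewrite ?mem_cat => ->; rewrite ?orbT.
Qed.

Lemma cylinder_in (W : set J) j A : W j -> F j A -> cylinder W A.
Proof.
move=> Wj FA; exists [:: j], (fun=> A); split=> //.
  by move=> k; rewrite inE => /eqP ->.
by rewrite bigcap_seq big_seq1.
Qed.

Lemma cylinder_sub W1 W2 : W1 `<=` W2 -> cylinder W1 `<=` cylinder W2.
Proof.
move=> W12 A [s [B [us h ->]]]; exists s, B; split=> // j /h[/W12].
by split.
Qed.

Lemma sigma_block_cylinder W : sigma_block W `<=` <<s (cylinder W)>>.
Proof.
apply: smallest_sub => [|A [j Wj FA]]; first exact: smallest_sigma_algebra.
by apply: sub_sigma_algebra; exact: cylinder_in FA.
Qed.

Lemma blocks_independent (K : eqType) (V : K -> set J) :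
  (forall k k' j, V k j -> V k' j -> k = k') ->
  mutually_independent P (fun k => sigma_block (V k)).
Proof.
move=> disV s A us sA.
(* The induction carries an extra cylinder [C]: inside Dynkin's argument the event of the first
   block is itself a cylinder, and it is absorbed into [C] before the remaining blocks are
   treated. *)
suff h C W : cylinder W C -> (forall k, k \in s -> V k `&` W = set0) ->
    P (\big[setI/setT]_(k <- s) A k `&` C) =
    (\prod_(k <- s) P (A k)) * P C.
  rewrite -[X in P X]setIT (h _ set0) ?probability_setT ?mule1 //.
    by exists [::], (fun=> setT); split=> //; rewrite bigcap_seq big_nil.
  by move=> *; rewrite setI0.
elim: s us sA C W => [|k s IH] us sA C W CW dW.
  by rewrite !big_nil setTI mul1e.
move: us => /= /andP[ks us].
have sA' j : j \in s -> sigma_block (V j) (A j).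
  by move=> js; apply: sA; rewrite inE js orbT.
have dW' j : j \in s -> V j `&` W = set0.
  by move=> js; apply: dW; rewrite inE js orbT.
rewrite !big_cons -setIA.
have mA j : j \in s -> measurable (A j).
  by move=> /sA'; exact: sigma_block_measurable.
have mS : measurable (\big[setI/setT]_(j <- s) A j).
  by rewrite big_seq; apply: big_ind => //; exact: measurableI.
have mC := cylinder_measurable CW.
rewrite (@indep_g_sigma (cylinder (V k))).
- by rewrite (IH us sA' C W CW dW') muleA.
- move=> E1 E2 c1 c2; have := cylinderI c1 c2; by rewrite setUid.
- exact: cylinder_measurable.
- exact: measurableI.
- move=> E cE; rewrite setICA (IH us sA' _ (V k `|` W)).
  + rewrite (cylinder_indep _ cE CW); last by apply: dW; rewrite mem_head.
    by rewrite (IH us sA' C W CW dW') muleCA.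
  + exact: cylinderI.
  + move=> j js; rewrite setIUr dW' // setU0.
    apply/seteqP; split=> // i [Vji Vki]; move: ks.
    by rewrite -(disV _ _ _ Vji Vki) js.
- by apply: sigma_block_cylinder; apply: sA; rewrite mem_head.
Qed.

Lemma sigma_block_sub W1 W2 : W1 `<=` W2 -> sigma_block W1 `<=` sigma_block W2.
Proof.
move=> W12; apply: smallest_sub; first exact: smallest_sigma_algebra.
move=> A [j /W12 Wj FA]; apply: sub_sigma_algebra; by exists j.
Qed.

End Blocks.
End Independence.

(** * Independent sequences of discrete random variables *)

Section UnitInterval.
Variable R : realType.

(** Lebesgue measure of the part inside [0, 1), but carried by the whole line; variables on it
    therefore need a value outside [0, 1) too. *)
Definition unit_measure : set (measurableTypeR R) -> \bar R :=
  mrestr (@lebesgue_measure R) (measurable_itv `[0%R, 1%R[).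

HB.instance Definition _ := Measure.on unit_measure.

Let unit_measureT : unit_measure setT = 1%E.
Proof.
rewrite /unit_measure /mrestr setTI lebesgue_measure_itv /= lte_fin ltr01.
by rewrite oppr0 adde0.
Qed.

HB.instance Definition _ :=
  Measure_isProbability.Build _ _ _ unit_measure unit_measureT.

End UnitInterval.

Section IndependentSequence.
Variable R : realType.
Implicit Types (q : nat -> R) (Q : nat -> nat -> R) (u : R).

(* Cutting [0, 1) into consecutive intervals of lengths q 0, q 1, ..., the digit
   of u is the index of its interval and the residual its relative position in
   it; iterating on the residual gives independent digits. *)
Definition partial_sum q k : R := \sum_(0 <= j < k) q j.

Definition digit q u : nat :=
  xget 0%N [set k | partial_sum q k <= u < partial_sum q k.+1].

Definition residual q u : R :=
  (u - partial_sum q (digit q u)) / q (digit q u).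

Fixpoint digits Q n u : nat :=
  if n is n'.+1 then digits (fun m => Q m.+1) n' (residual (Q 0%N) u)
  else digit (Q 0%N) u.

Definition is_pmf q := (forall k, 0 <= q k) /\ partial_sum q k @[k --> \oo] --> (1 : R).

Lemma partial_sumS q k : partial_sum q k.+1 = partial_sum q k + q k.
Proof. by rewrite /partial_sum big_nat_recr. Qed.

Lemma partial_sum_homo q : is_pmf q -> {homo partial_sum q : m n / (m <= n)%N >-> m <= n}.
Proof.
move=> [q0 _] m n mn; rewrite -(subnKC mn); elim: (n - m)%N => [|k IH].
  by rewrite addn0.
by rewrite addnS partial_sumS ler_wpDr.
Qed.

Lemma partial_sum_le1 q k : is_pmf q -> partial_sum q k <= 1.
Proof.
move=> qp; have [q0 q1] := qp.
rewrite -(cvg_lim _ q1) //; apply: limr_ge; first by apply/cvg_ex; exists 1.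
by exists k => // n /= kn; exact: partial_sum_homo.
Qed.

Lemma partial_sum_ge0 q k : is_pmf q -> 0 <= partial_sum q k.
Proof. by move=> [q0 _]; rewrite /partial_sum sumr_ge0. Qed.

Lemma digit_unique q u k : is_pmf q ->
  partial_sum q k <= u < partial_sum q k.+1 -> digit q u = k.
Proof.
move=> qp /andP[ku uk]; apply: xget_unique => /=; first by rewrite ku uk.
move=> j /andP[ju uj]; apply/eqP; rewrite eqn_leq -ltnS -[X in _ && X]ltnS.
apply/andP; split; rewrite ltnNge; apply/negP => /(partial_sum_homo qp) h.
  by move: (lt_le_trans uk h); rewrite ltNge ju.
by move: (lt_le_trans uj h); rewrite ltNge ku.
Qed.

Lemma digitP q u : is_pmf q -> 0 <= u < 1 ->
  partial_sum q (digit q u) <= u < partial_sum q (digit q u).+1.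
Proof.
move=> qp /andP[u0 u1]; have [q0 q1] := qp.
have [n un] : exists n, u < partial_sum q n.
  have : \forall n \near \oo, u < partial_sum q n by exact: cvgr_gt q1 _ u1.
  by move=> [n _ /(_ n (leqnn n))]; exists n.
have ex : exists n, u < partial_sum q n by exists n.
case: (ex_minnP ex) => -[|m] um mmin.
  by move: um; rewrite /partial_sum big_geq // ltNge u0.
have mu : partial_sum q m <= u.
  by rewrite leNgt; apply/negP => /mmin; rewrite ltnn.
by rewrite (@digit_unique q u m) ?mu.
Qed.

(** Prescribing the first digit selects an interval that the residual maps affinely onto [0, 1); the
    interval prescribed by the later digits is pulled back along this map, which multiplies its
    length by the mass of the first digit. *)
Lemma digits_itv Q (ks : seq nat) : (forall n, is_pmf (Q n)) ->
  exists a, [set u | 0 <= u < 1 /\ forall i, (i < size ks)%N ->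
                     digits Q i u = nth 0%N ks i] =
    [set u | a <= u < a + \prod_(i < size ks) Q i (nth 0%N ks i)].
Proof.
elim: ks Q => [|k ks IH] Q pQ.
  exists 0; apply/seteqP; split=> u /=; rewrite big_ord0 add0r; first by case.
  by move=> u01; split.
have [a Ea] := IH (fun n => Q n.+1) (fun n => pQ n.+1).
set pi' := \prod_(i < _) _ in Ea.
have -> : \prod_(i < size (k :: ks)) Q i (nth 0%N (k :: ks) i) = Q 0%N k * pi'.
  by rewrite big_ord_recl.
(* A digit of mass 0 never occurs, and the interval of length 0 is empty. *)
have [qk0|qk0] := eqVneq (Q 0%N k) 0.
  exists 0; apply/seteqP; split=> u /=; rewrite qk0 mul0r add0r; last first.
    by case/andP => u0 /(le_lt_trans u0); rewrite ltxx.
  move=> [u01 /(_ 0%N isT) /= uk]; have := digitP (pQ 0%N) u01.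
  by rewrite uk partial_sumS qk0 addr0 => /andP[] /le_lt_trans/[apply]; rewrite ltxx.
have qk : 0 < Q 0%N k by rewrite lt_def qk0 (pQ 0%N).1.
set S := partial_sum (Q 0%N) k.
exists (S + Q 0%N k * a).
have rescale u : (S + Q 0%N k * a <= u < S + Q 0%N k * a + Q 0%N k * pi') =
    (a <= (u - S) / Q 0%N k < a + pi').
  rewrite ler_pdivlMr // ltr_pdivrMr // lerBrDr ltrBlDr.
  by rewrite mulrDl ![_ * Q 0%N k]mulrC [S + _]addrC addrAC.
apply/seteqP; split=> u /=; rewrite rescale.
  move=> [u01 h]; have /= uk := h 0%N isT; have := digitP (pQ 0%N) u01.
  rewrite uk partial_sumS -/S => /andP[Su uS].
  suff : [set u | a <= u < a + pi'] ((u - S) / Q 0%N k) by [].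
  rewrite -Ea /=; split.
    rewrite divr_ge0 ?subr_ge0 ?(ltW qk) //= ltr_pdivrMr // mul1r.
    by rewrite ltrBlDl.
  move=> i ik; have /= := h i.+1 ik.
  by rewrite /residual uk.
move=> ua; have : [set u | a <= u < a + pi'] ((u - S) / Q 0%N k) by [].
rewrite -Ea /= => -[/andP[r0 r1] h].
have Su : S <= u by move: r0; rewrite ler_pdivlMr // mul0r subr_ge0.
have uS : u < S + Q 0%N k by move: r1; rewrite ltr_pdivrMr // mul1r ltrBlDl.
have uk : digit (Q 0%N) u = k.
  by apply: digit_unique => //; rewrite partial_sumS Su.
split.
  rewrite (le_trans (partial_sum_ge0 k (pQ 0%N)) Su) /= (lt_le_trans uS) //.
  by rewrite -partial_sumS partial_sum_le1.
by case=> [|i] //= ik; rewrite /residual uk -/S h.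
Qed.

Lemma digits_measurable Q n k : (forall n, is_pmf (Q n)) ->
  measurable [set u : measurableTypeR R | 0 <= u < 1 /\ digits Q n u = k].
Proof.
move=> pQ; rewrite [X in measurable X](_ : _ =
  [set u | exists ks : n.-tuple nat, 0 <= u < 1 /\
     forall i, (i < size (rcons ks k))%N -> digits Q i u = nth 0%N (rcons ks k) i]).
  apply: measurable_ex => ks; have [a ->] := digits_itv (rcons ks k) pQ.
  rewrite [X in measurable X](_ : _ =
    [set` `[a, a + \prod_(i < size (rcons ks k)) Q i (nth 0%N (rcons ks k) i)[]).
    exact: measurable_itv.
  by apply/seteqP; split=> u /=; rewrite in_itv.
apply/seteqP; split=> u /=.
  move=> [u01 uk]; have sz : size (mkseq (fun i => digits Q i u) n) == n.
    by rewrite size_mkseq.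
  exists (Tuple sz); split=> // i /=; rewrite size_rcons size_mkseq ltnS.
  rewrite nth_rcons size_mkseq leq_eqVlt => /predU1P[->|i_n].
    by rewrite ltnn eqxx.
  by rewrite i_n nth_mkseq.
move=> [ks [u01 h]]; split=> //.
rewrite h ?size_rcons ?size_tuple //.
by rewrite nth_rcons size_tuple ltnn eqxx.
Qed.

Definition coordinate Q n (u : measurableTypeR R) : nat :=
  if 0 <= u < 1 then digits Q n u else 0%N.

Lemma coordinate_measurable Q n k : (forall n, is_pmf (Q n)) ->
  measurable (coordinate Q n @^-1` [set k]).
Proof.
move=> pQ; rewrite [X in measurable X](_ : _ =
    [set u : measurableTypeR R | 0 <= u < 1 /\ digits Q n u = k] `|`
    (~` `[0%R, 1%R[%classic `&` [set _ | 0%N = k])).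
  apply: measurableU; first exact: digits_measurable.
  apply: measurableI; last exact: measurable_prop.
  by apply: measurableC; exact: measurable_itv.
apply/seteqP; split=> u /=; rewrite /coordinate in_itv /=.
  by case: ifP => u01; [left | right; split].
by case: ifP => u01 [[]|[]].
Qed.

Lemma coordinate_prefix Q (k : nat -> nat) N : (forall n, is_pmf (Q n)) ->
  unit_measure (\bigcap_(n in [set` iota 0 N]) (coordinate Q n @^-1` [set k n])) =
  (\prod_(n <- iota 0 N) Q n (k n))%:E.
Proof.
move=> pQ; have [a Ea] := digits_itv (mkseq k N) pQ.
have pr0 : 0 <= \prod_(n <- iota 0 N) Q n (k n).
  by apply: prodr_ge0 => n _; have [] := pQ n.
rewrite /unit_measure /mrestr.
have -> : \bigcap_(n in [set` iota 0 N]) (coordinate Q n @^-1` [set k n])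
    `&` `[0%R, 1%R[%classic = `[a, a + \prod_(n <- iota 0 N) Q n (k n)[%classic.
  transitivity [set u | 0 <= u < 1 /\ forall i, (i < size (mkseq k N))%N ->
                     digits Q i u = nth 0%N (mkseq k N) i].
    rewrite size_mkseq; apply/seteqP; split=> u /=.
      rewrite in_itv /= => -[h u01]; split=> // i iN.
      have := h i; rewrite /= mem_iota iN /coordinate u01 => ->//.
      by rewrite nth_mkseq.
    rewrite in_itv /= => -[u01 h]; split=> // i /=.
    by rewrite mem_iota /= /coordinate u01 => iN; rewrite h // nth_mkseq.
  rewrite Ea size_mkseq.
  rewrite -(big_mkord xpredT (fun i => Q i (nth 0%N (mkseq k N) i))).
  rewrite /index_iota subn0 (_ : \prod_(i <- iota 0 N) Q i (nth _ _ i) =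
     \prod_(n <- iota 0 N) Q n (k n)); last first.
    rewrite big_seq [RHS]big_seq; apply: eq_bigr => i.
    by rewrite mem_iota => /andP[_ iN]; rewrite nth_mkseq.
  by apply/seteqP; split=> u /=; rewrite in_itv.
rewrite lebesgue_measure_itv /= lte_fin ltrDl.
case: ifPn => [_|]; first by rewrite -EFinB addrAC subrr add0r.
by rewrite -leNgt => pr1; congr EFin; apply/le_anti; rewrite pr0.
Qed.

(** Only initial segments of coordinates are given by an interval. A missing coordinate is filled in
    by summing over its values, whose masses add up to 1. *)
Lemma coordinate_cylinder Q (k : nat -> nat) (s : seq nat) :
  (forall n, is_pmf (Q n)) -> uniq s ->
  unit_measure (\bigcap_(n in [set` s]) (coordinate Q n @^-1` [set k n])) =
  (\prod_(n <- s) Q n (k n))%:E.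
Proof.
move=> pQ.
have [N sN] : exists N, {subset s <= iota 0 N}.
  exists (\max_(n <- s) n).+1 => n ns.
  by rewrite mem_iota /= add0n ltnS; exact: leq_bigmax_seq.
(* Induction on the number of indices below [N] that are missing from [s]. *)
move=> us; have [c cE] : exists c, c = (N - size s)%N by eexists.
elim: c s k us sN cE => [|c IH] s k us sN cE.
  have pe : perm_eq s (iota 0 N).
    have [|_ e] := uniq_min_size us sN.
      by rewrite size_iota -subn_eq0 -cE.
    by apply: uniq_perm => //; exact: iota_uniq.
  rewrite (perm_big _ pe) -(coordinate_prefix k N pQ).
  rewrite (_ : [set` s] = [set` iota 0 N]) //.
  by apply/seteqP; split=> n /=; rewrite (perm_mem pe).
have [n nN ns] : exists2 n, n \in iota 0 N & n \notin s.
  apply/allPn; apply/negP => /allP h.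
  have := uniq_leq_size (iota_uniq 0 N) h.
  by rewrite size_iota -subn_eq0 -cE.
have mS : measurable (\bigcap_(i in [set` s]) (coordinate Q i @^-1` [set k i])).
  by apply: fin_bigcap_measurable => // i _; exact: coordinate_measurable.
pose k' l i := if i == n then l else k i.
have h l : unit_measure (\bigcap_(i in [set` n :: s]) (coordinate Q i @^-1` [set k' l i]))
   = (Q n l * \prod_(i <- s) Q i (k i))%:E.
  rewrite IH /= ?ns //.
  - rewrite big_cons /k' eqxx; congr (_ * _)%:E.
    rewrite big_seq [RHS]big_seq; apply: eq_bigr => i si.
    by case: eqP si => // ->; rewrite (negPf ns).
  - by move=> i; rewrite inE => /predU1P[->|/sN].
  - by rewrite subnS -cE.
have -> : \bigcap_(i in [set` s]) (coordinate Q i @^-1` [set k i]) =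
  \bigcup_l \bigcap_(i in [set` n :: s]) (coordinate Q i @^-1` [set k' l i]).
  apply/seteqP; split=> u.
    move=> hu; exists (coordinate Q n u) => // i /=; rewrite inE /k'.
    by case: eqVneq => [->|_] //= => /hu.
  move=> [l _ hu] i /= si; have := hu i; rewrite /= inE si orbT /k' => /(_ isT).
  by case: eqP si => // ->; rewrite (negPf ns).
have tr : trivIset setT
    (fun l => \bigcap_(i in [set` n :: s]) (coordinate Q i @^-1` [set k' l i])).
  move=> l m _ _ [u [/(_ n) hl /(_ n) hm]]; move: hl hm.
  by rewrite /= mem_head /k' eqxx => /(_ isT) <- /(_ isT) <-.
have ml l : measurable (\bigcap_(i in [set` n :: s]) (coordinate Q i @^-1` [set k' l i])).
  by apply: fin_bigcap_measurable => // i _; exact: coordinate_measurable.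
rewrite measure_semi_bigcup //; last exact: bigcup_measurable.
transitivity (\sum_(0 <= l <oo) ((\prod_(i <- s) Q i (k i))%:E * (Q n l)%:E))%E.
  by apply: eq_eseriesr => l _; rewrite muleC -EFinM; exact: h.
have pr0 : 0 <= \prod_(i <- s) Q i (k i).
  by apply: prodr_ge0 => i _; have [] := pQ i.
rewrite nneseriesZl; last by move=> l _; rewrite lee_fin; have [] := pQ n.
suff -> : (\sum_(0 <= l <oo) (Q n l)%:E = 1)%E by rewrite mule1.
apply: cvg_lim => //.
under eq_fun do rewrite sumEFin.
by apply: cvg_EFin; [exact: nearW | have [] := pQ n].
Qed.

(** [set0] makes the fibers stable under intersection and [setT] allows an index to be ignored, as
    [blocks_independent] requires. *)
Definition point_events d (T : measurableType d) (X : T -> nat) : set_system T :=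
  [set A | [\/ A = setT, A = set0 | exists k, A = X @^-1` [set k]]].

Lemma point_events_setI d (T : measurableType d) (X : T -> nat) :
  setI_closed (point_events X).
Proof.
move=> A B [->|->|[k ->]]; rewrite ?setTI ?set0I //; first by move=> _; apply: Or32.
move=> [->|->|[l ->]]; rewrite ?setIT ?setI0; first by apply: Or33; exists k.
  by apply: Or32.
case: (eqVneq k l) => [e|kl]; first by rewrite e setIid; apply: Or33; exists l.
apply: Or32; apply/seteqP; split=> // u [/= ek el].
by move: kl; rewrite -ek -el eqxx.
Qed.

Lemma independent_family (J : countType) (q : J -> nat -> R) :
  (forall j, is_pmf (q j)) ->
  exists X : J -> measurableTypeR R -> nat,
    [/\ forall j k, measurable (X j @^-1` [set k]),
        forall j k, @unit_measure R (X j @^-1` [set k]) = (q j k)%:E &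
        mutually_independent (@unit_measure R) (fun j => point_events (X j))].
Proof.
(* Where [unpickle] fails, the point mass at 0 gives the coordinate a law nonetheless. *)
move=> pq; pose Q n : nat -> R := if unpickle n is Some j then q j else
  fun k => (k == 0%N)%:R.
have pQ n : is_pmf (Q n).
  rewrite /Q; case: unpickle => [j|] //; split=> [k|]; first exact: ler0n.
  apply: cvg_near_cst; exists 1%N => // k /= k0.
  by rewrite /partial_sum big_ltn // big_nat big1 ?addr0 // => -[].
have QE j : Q (pickle j) = q j by rewrite /Q pickleK.
pose X (j : J) := coordinate Q (pickle j).
have mX j k : measurable (X j @^-1` [set k]) by exact: coordinate_measurable.
have cyl s (k : J -> nat) : uniq s ->
    unit_measure (\bigcap_(j in [set` s]) (X j @^-1` [set k j])) =
    (\prod_(j <- s) q j (k j))%:E.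
  move=> us; pose k' n := if unpickle n is Some j then k j else 0%N.
  have := @coordinate_cylinder Q k' (map pickle s) pQ.
  rewrite map_inj_uniq; last exact: pcan_inj pickleK.
  move=> /(_ us); rewrite big_map.
  under eq_bigr do rewrite QE /k' pickleK.
  move=> <-; congr unit_measure; apply/seteqP; split=> u /=.
    by move=> hu n /= /mapP[j js ->]; rewrite /k' pickleK; exact: hu.
  move=> hu j /= js; have := hu (pickle j); rewrite /= map_f // => /(_ isT).
  by rewrite /k' pickleK.
have one j k : unit_measure (X j @^-1` [set k]) = (q j k)%:E.
  have := cyl [:: j] (fun=> k) isT; rewrite big_seq1 => <-; congr unit_measure.
  by rewrite bigcap_seq big_seq1.
exists X; split=> // s A us sA.
(* An empty event makes both sides vanish; otherwise the indices with [setT] are dropped and only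
   fibers remain. *)
have [[j js Aj]|no0] := pselect (exists2 j, j \in s & A j = set0).
  rewrite -bigcap_seq (_ : \bigcap_(i in _) _ = set0); last first.
    by apply/seteqP; split=> // u /(_ j js); rewrite Aj.
  rewrite measure0 (perm_big _ (perm_to_rem js)) big_cons Aj /=.
  by rewrite (_ : unit_measure set0 = 0%E) ?mul0e // measure0.
pose s' := [seq j <- s | ~~ `[< A j = setT >]].
have /choice[k kP] j : exists k, j \in s' -> A j = X j @^-1` [set k].
  have [|_] := boolP (j \in s'); last by exists 0%N.
  rewrite mem_filter => /andP[/asboolPn AT js].
  have [//|A0|[k Ak]] := sA _ js; last by exists k.
  by case: no0; exists j.
have -> : \big[setI/setT]_(j <- s) A j =
    \bigcap_(j in [set` s']) (X j @^-1` [set k j]).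
  rewrite -bigcap_seq; apply/seteqP; split=> u hu j /=.
    move=> js'; have : A j u by apply: hu; move: js'; rewrite mem_filter => /andP[].
    by rewrite (kP j js').
  move=> js; have [AT|AT] := pselect (A j = setT); first by rewrite AT.
  have js' : j \in s' by rewrite mem_filter js andbT; exact/asboolPn.
  by rewrite (kP j js'); exact: hu.
rewrite [LHS](cyl s' k (filter_uniq _ us)).
rewrite -prodEFin /s' big_filter big_mkcond big_seq [RHS]big_seq.
apply: eq_bigr => j js; case: ifPn => [AT|/negPn/asboolP ->]; last first.
  by symmetry; exact: probability_setT.
have js' : j \in s' by rewrite mem_filter AT.
by rewrite (kP j js'); symmetry; exact: one.
Qed.

End IndependentSequence.

(** * Activation times *)

(** By well-ordering a finite infimum is attained. This produces actual particles and routes from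
    the infima that define passage and activation times. *)
Lemma ereal_inf_nat (R : realType) (S : set (\bar R)) :
  (forall z, S z -> z = +oo%E \/ exists n, z = n%:R%:E) ->
  ereal_inf S = +oo%E \/ exists2 n, S n%:R%:E & ereal_inf S = n%:R%:E.
Proof.
move=> Sn; have [ex|nex] := pselect (exists n, `[< S n%:R%:E >]).
  right; case: (ex_minnP ex) => m /asboolP Sm mmin; exists m => //.
  apply/le_anti/andP; split; first exact: ereal_inf_lbound.
  apply/ereal_infP => z Sz; have [->|[n zn]] := Sn z Sz; first exact: leey.
  by rewrite zn lee_fin ler_nat; apply: mmin; rewrite -zn; exact/asboolP.
left; apply/eqP; rewrite -leye_eq; apply/ereal_infP => z Sz.
have [->//|[n zn]] := Sn z Sz.
by case: nex; exists n; rewrite -zn; exact/asboolP.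
Qed.

Arguments fm_eta {R G p d0 T0 P0 eta} _ _.
Arguments fm_walk {R G p d0 T0 P0 eta} _ _ _ _ _.
Arguments fm_life {R G p d0 T0 P0 eta} _ _ _ _.
Arguments survival {R G p d0 T0 P0 eta} _ _.

Local Notation root := Defs.root.

Section Dynamics.
Variables (R : realType) (G : rooted_graph) (p : R) (d0 : measure_display).
Variables (T0 : measurableType d0) (P0 : probability T0 R).
Variables (eta : {RV P0 >-> nat}) (M : frog_model G p eta).
Implicit Types (w : fm_space M) (x y : G) (n N m k : nat).

Definition hop w x y m : Prop := exists i,
  [/\ (i < fm_eta M x w)%N, alive (fm_life M x i w) m & fm_walk M x i m w = y].

Lemma passage_time_le w x y m : hop w x y m ->
  (passage_time w x y <= m%:R%:E)%E.
Proof. by move=> h; apply: ereal_inf_lbound; exists m. Qed.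

Lemma passage_time_val w x y : passage_time w x y = +oo%E \/
  exists2 m, hop w x y m & passage_time w x y = m%:R%:E.
Proof.
have -> : passage_time w x y = ereal_inf [set n%:R%:E | n in hop w x y] by [].
have [|->|[m [n h nm] ->]] := @ereal_inf_nat R [set n%:R%:E | n in hop w x y].
- by move=> z [n _ <-]; right; exists n.
- by left.
- right; exists m => //; move: nm => [] /eqP; rewrite eqr_nat => /eqP <-.
  exact: h.
Qed.

Lemma route_time_rcons w x s y :
  route_time w x (rcons s y) = (route_time w x s + passage_time w (last x s) y)%E.
Proof.
elim: s x => [|z s IH] x /=; first by rewrite adde0 add0e.
by rewrite IH addeA.
Qed.

(** A countable substitute for [route_time]: each hop takes the time of some particle, not
    necessarily the least one, so that measurability reduces to countable unions. *)
Fixpoint reach w k x N : Prop :=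
  if k is k'.+1 then exists y m N',
    [/\ reach w k' y N', y != x, hop w y x m & N = (N' + m)%N]
  else x = root /\ N = 0%N.

Lemma route_time_val w x s : route_time w x s = +oo%E \/
  exists N, route_time w x s = N%:R%:E.
Proof.
elim: s x => [|y s IH] x /=; first by right; exists 0%N.
have [->|[N ->]] := IH y.
  by left; have [->|[m _ ->]] := passage_time_val w x y.
have [->|[m _ ->]] := passage_time_val w x y; first by left.
by right; exists (m + N)%N; rewrite natrD EFinD.
Qed.

Lemma reach_route w s N : path (fun y z => y != z) root s ->
  route_time w root s = N%:R%:E -> reach w (size s) (last root s) N.
Proof.
elim/last_ind: s N => [|s y IH] N.
  by move=> _ /= [] /eqP; rewrite eq_sym pnatr_eq0 => /eqP ->.
rewrite rcons_path route_time_rcons last_rcons size_rcons => /andP[ps ly].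
have [->|[N' e]] := route_time_val w root s.
  by have [->|[m _ ->]] := passage_time_val w (last root s) y.
rewrite e; have [->//|[m h ->]] := passage_time_val w (last root s) y.
rewrite -EFinD -natrD => -[] /eqP; rewrite eqr_nat => /eqP <-.
by exists (last root s), m, N'; split=> //; exact: IH.
Qed.

Lemma activation_time_le w k x N : reach w k x N ->
  (activation_time w x <= N%:R%:E)%E.
Proof.
move=> h; suff [s [ps ls rs]] : exists s, [/\ path (fun y z => y != z) root s,
    last root s = x & (route_time w root s <= N%:R%:E)%E].
  by apply: le_trans rs; apply: ereal_inf_lbound; exists s.
elim: k x N h => [|k IH] x N /=.
  by move=> [-> ->]; exists [::].
move=> [y [m [N' [/IH[s [ps ls rs]] yx h ->]]]].
exists (rcons s x); rewrite rcons_path last_rcons ps ls yx; split=> //.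
rewrite route_time_rcons ls natrD EFinD; apply: leeD => //.
exact: passage_time_le.
Qed.

Definition active_at w x N := activation_time w x = N%:R%:E.

Lemma activation_time_val w x : activation_time w x = +oo%E \/
  exists N k, active_at w x N /\ reach w k x N.
Proof.
rewrite /active_at /activation_time.
have [|->|[N [s [ps ls] e] eN]] := @ereal_inf_nat R [set route_time w root s | s in
    [set s | path (fun y z => y != z) root s /\ last root s = x]].
- move=> z [s _ <-]; exact: route_time_val.
- by left.
- by right; exists N, (size s); split=> //; rewrite -ls; exact: reach_route.
Qed.

Lemma active_atP w x N : active_at w x N <->
  (exists k, reach w k x N) /\ forall k N', reach w k x N' -> (N <= N')%N.
Proof.
split=> [TN|[[k r] mi]].
  split=> [|k N' /activation_time_le].
    have [e|[N' [k []]]] := activation_time_val w x; first by move: TN; rewrite /active_at e.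
    rewrite /active_at TN => -[] /eqP; rewrite eqr_nat => /eqP ->.
    by exists k.
  by rewrite TN lee_fin ler_nat.
have [|[N' [k' [TN' r']]]] := activation_time_val w x.
  by have := activation_time_le r => /[swap] ->.
have := activation_time_le r; rewrite TN' lee_fin ler_nat => N'N.
rewrite /active_at TN'; congr (_%:R%:E); apply/eqP.
by rewrite eqn_leq N'N (mi _ _ r').
Qed.

Lemma reach_active w k x N : reach w k x N ->
  exists2 N', (N' <= N)%N & active_at w x N'.
Proof.
move=> /activation_time_le.
have [->//|[N' [k' [TN _]]]] := activation_time_val w x.
by rewrite TN lee_fin ler_nat => ?; exists N'.
Qed.

Lemma active_at_inj w x N N' : active_at w x N -> active_at w x N' -> N = N'.
Proof. by rewrite /active_at => -> [] /eqP; rewrite eqr_nat => /eqP. Qed.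

Lemma active_hop w y x N m : active_at w y N -> hop w y x m ->
  exists2 N', (N' <= N + m)%N & active_at w x N'.
Proof.
have [-> TN _|yx] := eqVneq y x; first by exists N; rewrite // leq_addr.
move=> /active_atP[[k r] _] h; apply: (@reach_active _ k.+1).
by exists y, m, N.
Qed.

(** A prefix of an optimal route is optimal: reaching [y] earlier would activate [x] earlier. *)
Lemma last_hop w x N : active_at w x N -> (x = root /\ N = 0%N) \/
  exists y N' m, [/\ active_at w y N', y != x, hop w y x m & N = (N' + m)%N].
Proof.
move=> /active_atP[[[|k] /= r] mi]; first by left.
right; case: r => y [m [N1 [r yx h e]]]; exists y, N1, m; split=> //.
have [N2 N21 T2] := reach_active r.
rewrite (_ : N1 = N2) //; apply/eqP; rewrite eqn_leq N21 andbT.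
have /active_atP[[j rj] _] := T2.
rewrite -(leq_add2r m) -e; apply: (mi j.+1).
by exists y, m, N2.
Qed.

Lemma active_root w : active_at w root 0.
Proof.
have [|N] := @reach_active w 0 root 0; first by [].
by rewrite leqn0 => /eqP ->.
Qed.

Lemma particle_activeP w n x i : particle_active w n x i <->
  (i < fm_eta M x w)%N /\ exists m N,
    [/\ alive (fm_life M x i w) m, active_at w x N & (N + m)%N = n].
Proof.
split=> -[ie].
  move=> [m am e]; split=> //; move: e.
  have [->//|[N [k [TN _]]]] := activation_time_val w x.
  rewrite TN -EFinD -natrD => -[] /eqP; rewrite eqr_nat => /eqP e.
  by exists m, N.
move=> [m [N [am TN e]]]; split=> //; exists m => //.
by rewrite TN -EFinD -natrD e.
Qed.

Lemma alive_le l m n : (m <= n)%N -> alive l n -> alive l m.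
Proof. by case: l => [k|] //=; exact: leq_ltn_trans. Qed.

(** In a general realization [fm_walk_law] gives this only almost surely. *)
Definition proper_start w := forall x i, fm_walk M x i 0 w = x.

Lemma hop_gt0 w x y m : proper_start w -> x != y -> hop w x y m -> (0 < m)%N.
Proof.
move=> st xy [i [_ _ e]]; rewrite lt0n; apply/eqP => m0.
by move: xy; rewrite -e m0 st eqxx.
Qed.

(** Going back along an optimal route, some hop has time [t] within its duration; its particle is
    alive at the end of the hop, hence at [t]. *)
Lemma active_before w x N t : proper_start w -> active_at w x N -> (t < N)%N ->
  exists y i, particle_active w t y i.
Proof.
move=> st; have [n Nn] := ubnP N; elim: n => // n IH in x N Nn *.
move=> TN tN; have [[_ N0]|[y [N' [m [TN' yx h e]]]]] := last_hop TN.
  by rewrite N0 in tN.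
have m0 := hop_gt0 st yx h.
have [N't|tN'] := leqP N' t; last first.
  apply: (IH y N') => //; rewrite -ltnS; apply: leq_trans Nn.
  by rewrite ltnS e -addn1 leq_add2l.
case: h => i [ie ai _]; exists y, i; apply/particle_activeP; split=> //.
exists (t - N')%N, N'; split=> //; last by rewrite subnKC.
by apply: alive_le ai; rewrite leq_subLR -e ltnW.
Qed.

Lemma measurable_eta x (A : set nat) : measurable [set w | A (fm_eta M x w)].
Proof.
rewrite -[X in measurable X]setTI.
exact: (measurable_funPT (fm_eta M x)).
Qed.

Lemma measurable_alive x i m : measurable [set w | alive (fm_life M x i w) m].
Proof.
rewrite [X in measurable X](_ : _ = [set w | exists l : option nat,
    alive l m /\ fm_life M x i w = l]).
  apply: measurable_ex => l; apply: measurable_and2; first exact: measurable_prop.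
  exact: fm_life_measurable.
by apply/seteqP; split=> w /=; [move=> ?; eexists; split; eauto | move=> [l [? ->]]].
Qed.

Lemma measurable_walk x i n y : measurable [set w | fm_walk M x i n w = y].
Proof. exact: fm_walk_measurable. Qed.

Lemma measurable_hop x y m : measurable [set w | hop w x y m].
Proof.
apply: measurable_ex => i; rewrite [X in measurable X](_ : _ =
  [set w | (i < fm_eta M x w)%N /\ alive (fm_life M x i w) m /\
           fm_walk M x i m w = y]).
  apply: measurable_and2; first exact: (measurable_eta x [set k | (i < k)%N]).
  apply: measurable_and2; [exact: measurable_alive | exact: measurable_walk].
by apply/seteqP; split=> w /=; [case | case=> ? []].
Qed.

Lemma measurable_reach k x N : measurable [set w | reach w k x N].
Proof.
elim: k x N => [|k IH] x N /=; first exact: measurable_prop.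
apply: measurable_ex => y; apply: measurable_ex => m; apply: measurable_ex => N'.
rewrite [X in measurable X](_ : _ = [set w | reach w k y N' /\ hop w y x m /\
   (y != x /\ N = (N' + m)%N)]).
  apply: measurable_and2 => //; apply: measurable_and2; first exact: measurable_hop.
  exact: measurable_prop.
by apply/seteqP; split=> w /=; [case | case=> ? [? []]].
Qed.

Lemma measurable_active_at x N : measurable [set w | active_at w x N].
Proof.
rewrite [X in measurable X](_ : _ = [set w | (exists k, reach w k x N) /\
   forall k N', reach w k x N' -> (N <= N')%N]).
  apply: measurable_and2.
    by apply: measurable_ex => k; exact: measurable_reach.
  apply: measurable_all => k; apply: measurable_all => N'.
  rewrite [X in measurable X](_ : _ = [set w | ~ reach w k x N'] `|`
      [set _ | (N <= N')%N]).
    apply: measurableU; last exact: measurable_prop.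
    exact: measurableC (measurable_reach _ _ _).
  apply/seteqP; split=> w /=; last by case=> [nr /nr|].
  by have [r h|nr] := pselect (reach w k x N'); [right; exact: h | left].
by apply/seteqP; split=> w /= /active_atP.
Qed.

Lemma measurable_particle_active n x i :
  measurable [set w : fm_space M | particle_active w n x i].
Proof.
rewrite [X in measurable X](_ : _ = [set w | (i < fm_eta M x w)%N /\ exists m N,
    alive (fm_life M x i w) m /\ (active_at w x N /\ (N + m)%N = n)]).
  apply: measurable_and2; first exact: (measurable_eta x [set k | (i < k)%N]).
  apply: measurable_ex => m; apply: measurable_ex => N.
  apply: measurable_and2; first exact: measurable_alive.
  apply: measurable_and2; [exact: measurable_active_at | exact: measurable_prop].
apply/seteqP; split=> w /=.
  move=> /particle_activeP[ie [m [N [am TN e]]]]; split=> //.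
  by exists m, N.
move=> [ie [m [N [am [TN e]]]]]; apply/particle_activeP; split=> //.
by exists m, N.
Qed.

Lemma measurable_survival : measurable (survival M).
Proof.
apply: measurable_all => n; apply: measurable_ex => x; apply: measurable_ex => i.
exact: measurable_particle_active.
Qed.

End Dynamics.

(** * The lower bound *)

Section FirstMoment.
Variables (R : realType) (G : rooted_graph) (p : R) (d0 : measure_display).
Variables (T0 : measurableType d0) (P0 : probability T0 R).
Variables (eta : {RV P0 >-> nat}) (M : frog_model G p eta).
Hypothesis p01 : 0 <= p <= 1.
Implicit Types (w : fm_space M) (x y : G) (n N m k : nat).
Local Notation J := (G + (G * nat + G * nat))%type.
Local Notation P := (fm_prob M).

Definition site (j : J) : G :=
  match j with inl x => x | inr (inl (x, _)) => x | inr (inr (x, _)) => x end.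

Definition fm_sigma (j : J) : set_system (fm_space M) :=
  match j with
  | inl x => <<s [set A | exists k, A = fm_eta M x @^-1` [set k]] >>
  | inr (inl (x, i)) => <<s [set A | exists n y, A = fm_walk M x i n @^-1` [set y]] >>
  | inr (inr (x, i)) => <<s [set A | exists k : option nat, A = fm_life M x i @^-1` [set k]] >>
  end.

Lemma fm_sigma_independent : mutually_independent P fm_sigma.
Proof.
exact: (fm_independent (f := M)).
Qed.

Lemma fm_sigma_measurable j : fm_sigma j `<=` measurable.
Proof.
case: j => [x|[[x i]|[x i]]] /=; apply: smallest_sub;
  try exact: sigma_algebra_measurable.
- by move=> A [k ->]; exact: (measurable_eta M x [set k]).
- by move=> A [n [y ->]]; exact: fm_walk_measurable.
- by move=> A [k ->]; exact: fm_life_measurable.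
Qed.

Lemma fm_sigmaI j : setI_closed (fm_sigma j).
Proof.
by case: j => [x|[[x i]|[x i]]] /= A B; exact: (@measurableI _ (g_sigma_algebraType _)).
Qed.

Lemma fm_sigmaT j : fm_sigma j setT.
Proof.
by case: j => [x|[[x i]|[x i]]] /=; exact: (@measurableT _ (g_sigma_algebraType _)).
Qed.

Lemma sigma_etaE x (A : set nat) : fm_sigma (inl x) [set w | A (fm_eta M x w)].
Proof.
pose X := g_sigma_algebraType [set B | exists k, B = fm_eta M x @^-1` [set k]].
suff : measurable ([set w | A (fm_eta M x w)] : set X) by [].
rewrite [X in measurable X](_ : _ = [set w | exists k, A k /\ fm_eta M x w = k]).
  apply: measurable_ex => k; apply: measurable_and2; first exact: measurable_prop.
  by apply: sub_sigma_algebra; exists k.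
by apply/seteqP; split=> w /=; [exists (fm_eta M x w) | case=> k [? ->]].
Qed.

Lemma sigma_aliveE x i m :
  fm_sigma (inr (inr (x, i))) [set w | alive (fm_life M x i w) m].
Proof.
pose X := g_sigma_algebraType [set B | exists k : option nat, B = fm_life M x i @^-1` [set k]].
suff : measurable ([set w | alive (fm_life M x i w) m] : set X) by [].
rewrite [X in measurable X](_ : _ = [set w | exists l : option nat,
    alive l m /\ fm_life M x i w = l]).
  apply: measurable_ex => l; apply: measurable_and2; first exact: measurable_prop.
  by apply: sub_sigma_algebra; exists l.
by apply/seteqP; split=> w /=; [move=> ?; eexists; split; eauto | move=> [l [? ->]]].
Qed.

Lemma sigma_walkE x i m y :
  fm_sigma (inr (inl (x, i))) [set w | fm_walk M x i m w = y].
Proof. by apply: sub_sigma_algebra; exists m, y. Qed.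

Lemma geometric_partial_sum (q : R) m :
  \sum_(0 <= k < m) (1 - q) * q ^+ k = 1 - q ^+ m.
Proof.
rewrite big_mkord -mulr_sumr -opprB mulNr -subrX1 opprB.
by [].
Qed.

Lemma prob_alive x i m : P [set w | alive (fm_life M x i w) m] = (p ^+ m)%:E.
Proof.
have mA := measurable_alive M x i m.
(* The complement involves only the finite lifetimes up to [m], so that [p = 1], with its infinite
   lifetimes, is covered by the same computation. *)
rewrite -[X in P X]setCK probability_setC; last exact: measurableC.
suff -> : P (~` [set w | alive (fm_life M x i w) m]) = (1 - p ^+ m)%:E.
  by rewrite -EFinB opprB addrCA subrr addr0.
have -> : ~` [set w | alive (fm_life M x i w) m] =
    \bigcup_(k in [set` iota 0 m.+1]) (fm_life M x i @^-1` [set Some k]).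
  have ink k : [set` iota 0 m.+1] k = (k <= m)%N :> Prop.
    by rewrite /mkset mem_iota ltnS.
  apply/seteqP; split=> w.
    move=> nal; have {}nal : ~ alive (fm_life M x i w) m by [].
    case El: (fm_life M x i w) nal => [l|] nal.
      by exists l; rewrite ?ink // leqNgt; apply/negP.
    by case: nal.
  by move=> [k]; rewrite ink => km /= -> /=; apply/negP; rewrite -leqNgt.
rewrite measure_fin_bigcup //.
- rewrite -fsbig_seq ?iota_uniq //.
  rewrite (eq_bigr (fun k => (lifetime_pmf p (Some k))%:E)); last first.
    by move=> k _; exact: fm_life_law.
  rewrite sumEFin -[iota _ _]/(index_iota 0 m.+1) big_nat_recl //= add0r.
  by rewrite geometric_partial_sum.
- exact: finite_seq.
- by move=> k l _ _ [w [/= -> []]].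
- by move=> k _; exact: fm_life_measurable.
Qed.

Lemma prob_etaE x (A : set nat) :
  P [set w | A (fm_eta M x w)] = P0 [set w | A (eta w)].
Proof. exact: (law_eq A (fm_eta_law M x)). Qed.

(* k is a bound on the number of jumps, n the total duration and A the list of
   the sites already used. *)
Fixpoint fresh_chain w k n x (A : seq G) : Prop :=
  (exists i, (i < fm_eta M x w)%N /\ alive (fm_life M x i w) n) \/
  if k is k'.+1 then exists i m y,
    [/\ (0 < m <= n)%N && (y \notin A), (i < fm_eta M x w)%N,
        alive (fm_life M x i w) m, fm_walk M x i m w = y &
        fresh_chain w k' (n - m) y (y :: A)]
  else False.

Lemma fresh_chain_homo w k k' n x A : (k <= k')%N ->
  fresh_chain w k n x A -> fresh_chain w k' n x A.
Proof.
elim: k k' n x A => [|k IH] [|k'] n x A //= kk'; first by case=> [?|//]; left.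
case=> [?|[i [m [y [h1 h2 h3 h4 h5]]]]]; [by left | right].
by exists i, m, y; split=> //; exact: IH.
Qed.

(* Activation times increase strictly along an optimal route, so that its sites
   are distinct and their particles independent. *)
Lemma active_fresh_chain w x N n : proper_start w -> active_at w x N ->
  (forall A, x \in A ->
     (forall z, z \in A -> exists2 N', (N' <= N)%N & active_at w z N') ->
     fresh_chain w n n x A) ->
  fresh_chain w (N + n) (N + n) root [:: root].
Proof.
(* The route is unrolled from its end by [last_hop], whereas a chain is built from the root: hence
   the hypothesis giving the rest of the chain for any admissible list of used sites. *)
move=> st; have [b Nb] := ubnP N; elim: b => // b IH in x N Nb n *.
move=> TN H; have [[x0 N0]|[y [N' [m [TN' yx h e]]]]] := last_hop TN.
  rewrite N0 add0n -x0; apply: H; first exact: mem_head.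
  by move=> z; rewrite inE x0 => /eqP ->; exists N; rewrite // -x0.
have m0 := hop_gt0 st yx h.
have N'N : (N' < N)%N by rewrite e -[X in (X < _)%N]addn0 ltn_add2l.
rewrite e -addnA; apply: (IH y) => //.
  by rewrite -ltnS; exact: leq_ltn_trans Nb.
move=> A yA HA; case: h => i [ie ai wi].
have -> : fresh_chain w (m + n) = fresh_chain w (m.-1 + n).+1.
  by rewrite -addSn prednK.
right; exists i, m, x; rewrite m0 leq_addr addKn; split=> //=.
  (* [x] is fresh because the sites of [A] are active by time [N'], strictly before [N]. *)
  apply/negP => /HA[N2 N2N' TN2]; have := active_at_inj TN TN2 => NN2.
  by move: N'N; rewrite NN2 ltnNge N2N'.
apply: (@fresh_chain_homo w n); first exact: leq_addl.
apply: H; first exact: mem_head.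
move=> z; rewrite inE => /predU1P[->|/HA[N2 N2N' TN2]]; first by exists N.
by exists N2 => //; apply: leq_trans N2N' (ltnW N'N).
Qed.

Lemma survival_fresh_chain w n : proper_start w -> survival M w ->
  fresh_chain w n n root [:: root].
Proof.
move=> st /(_ n)[x [i /particle_activeP[ie [m [N [am TN <-]]]]]].
apply: (active_fresh_chain st TN) => A xA _.
by case: m am => [|m] am; left; exists i.
Qed.

Lemma measurable_fresh_chain k n x A : measurable [set w | fresh_chain w k n x A].
Proof.
have m0 i y l : measurable [set w | (i < fm_eta M y w)%N /\ alive (fm_life M y i w) l].
  apply: measurable_and2; first exact: (measurable_eta M y [set k | (i < k)%N]).
  exact: measurable_alive.
elim: k n x A => [|k IH] n x A /=; apply: measurableU.
- by apply: measurable_ex => i.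
- exact: measurable_prop.
- by apply: measurable_ex => i.
apply: measurable_ex => i; apply: measurable_ex => m; apply: measurable_ex => y.
rewrite [X in measurable X](_ : _ = [set w | (0 < m <= n)%N && (y \notin A) /\
   (((i < fm_eta M x w)%N /\ alive (fm_life M x i w) m) /\
    (fm_walk M x i m w = y /\ fresh_chain w k (n - m) y (y :: A)))]).
  apply: measurable_and2; first exact: measurable_prop.
  apply: measurable_and2 => //.
  by apply: measurable_and2; [exact: measurable_walk | exact: IH].
by apply/seteqP; split=> w /=; [case | case=> ? [[? ?] [? ?]]].
Qed.

Variable a : R.
Hypothesis Ea : ('E_P0[fun u => (eta u)%:R : R] = a%:E)%E.

Let bound n : R := a * (p * (1 + a)) ^+ n.

Let a0 : 0 <= a.
Proof. by rewrite -lee_fin -Ea; apply: expectation_ge0 => w; exact: ler0n. Qed.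

Let p0 : 0 <= p. Proof. by case/andP: p01. Qed.

Let bound0 n : 0 <= bound n.
Proof. by rewrite mulr_ge0 // exprn_ge0 // mulr_ge0 // addr_ge0. Qed.

(** The renewal equation for the expected number of chains: a particle either lives through the
    whole duration [n], or hops after [m.+1] steps and leaves [n - m.+1]. Factoring out [p ^+ n]
    leaves a geometric sum in [1 + a]. *)
Let bound_rec n : bound n = a * (p ^+ n + \sum_(m < n) p ^+ m.+1 * bound (n - m.+1)).
Proof.
rewrite /bound; congr (_ * _).
have -> : \sum_(m < n) p ^+ m.+1 * (a * (p * (1 + a)) ^+ (n - m.+1)) =
    p ^+ n * (a * \sum_(m < n) (1 + a) ^+ m).
  rewrite [X in _ * (_ * X)](reindex_inj rev_ord_inj) /= !mulr_sumr.
  apply: eq_bigr => m _; rewrite exprMn mulrCA.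
  rewrite !mulrA -[X in _ = p ^+ X * _ * _](subnKC (ltn_ord m)) exprD.
  by rewrite [a * _]mulrC -!mulrA; congr (_ * _); rewrite !mulrA [a * _]mulrC.
have -> : a * \sum_(m < n) (1 + a) ^+ m = (1 + a) ^+ n - 1.
  by rewrite subrX1 (addrAC 1) subrr add0r.
by rewrite exprMn mulrBr mulr1 addrCA subrr addr0.
Qed.

Local Notation cyl A := (cylinder fm_sigma [set j | site j \in A]).

Lemma cyl_measurable (A : seq G) H : cyl A H -> measurable H.
Proof. by apply: cylinder_measurable; exact: fm_sigma_measurable. Qed.

Lemma cyl_first_step (A : seq G) H x i m : x \notin A -> cyl A H ->
  let S := H `&` [set w | (i < fm_eta M x w)%N] `&`
           [set w | alive (fm_life M x i w) m] in
  cyl (x :: A) S /\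
  pr P S = pr P H * pr P [set w | (i < fm_eta M x w)%N] * p ^+ m.
Proof.
move=> xA cH S; have cI := cylinderI fm_sigmaI fm_sigmaT.
have c1 : cylinder fm_sigma [set inl x] [set w | (i < fm_eta M x w)%N].
  exact (cylinder_in (F := fm_sigma) (j := inl x) (erefl _) (sigma_etaE (x := x) [set k | (i < k)%N])).
have c2 : cylinder fm_sigma [set inr (inr (x, i))] [set w | alive (fm_life M x i w) m].
  exact: (cylinder_in (j := inr (inr (x, i))) (erefl _) (@sigma_aliveE x i m)).
have c12 := cI _ _ _ _ (cI _ _ _ _ cH c1) c2.
split.
  apply: cylinder_sub c12 => j [[|]|] /=; rewrite inE.
  - by move=> ->; rewrite orbT.
  - by move=> ->; rewrite /= eqxx.
  - by move=> ->; rewrite /= eqxx.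
rewrite /pr (cylinder_indep fm_sigma_independent _ (cI _ _ _ _ cH c1) c2); last first.
  apply/seteqP; split=> // j [+ e]; rewrite e /= => -[|//].
  by rewrite (negPf xA).
rewrite (cylinder_indep fm_sigma_independent _ cH c1); last first.
  by apply/seteqP; split=> // j [+ e]; rewrite e /= (negPf xA).
rewrite prob_alive (prE P (cyl_measurable cH)).
by rewrite (prE P (measurable_eta M x [set k | (i < k)%N])).
Qed.

(** [H] is the past of the chain, an event on the sites already used. Carrying it through the
    induction replaces conditioning, since a fresh site brings variables independent of [H]. *)
Lemma fresh_chain_bound k n x A H : x \notin A -> cyl A H ->
  pr P (H `&` [set w | fresh_chain w k n x (x :: A)]) <= pr P H * bound n.
Proof.
elim: k n x A H => [|k IH] n x A H xA cH.
all: have mH := cyl_measurable cH.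
all: pose q i := pr P [set w | (i < fm_eta M x w)%N].
all: pose S i m := H `&` [set w | (i < fm_eta M x w)%N] `&`
           [set w | alive (fm_life M x i w) m].
all: have mS i m : measurable (S i m).
1,3: by have [/cyl_measurable] := cyl_first_step i m xA cH.
all: have prS i m : pr P (S i m) = pr P H * q i * p ^+ m.
1,3: by have [] := cyl_first_step i m xA cH.
(* Summing over the particles [i] of [x]: the tail probabilities [q i] add up to the mean [a]. *)
all: have main (F : nat -> set (fm_space M)) : (forall i, measurable (F i)) ->
  (forall i, pr P (F i) <= q i * (pr P H * (p ^+ n + \sum_(m < n) p ^+ m.+1 * bound (n - m.+1)))) ->
  pr P (\bigcup_i F i) <= pr P H * bound n.
1,3: move=> mF hF; rewrite -lee_fin -prE; last exact: bigcup_measurable.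
1,2: apply: le_trans (measure_bigcup_nat_le P mF) _.
1,2: rewrite bound_rec mulrCA EFinM -Ea expectation_nat muleC.
1,2: rewrite -nneseriesZl //; apply: lee_nneseries => // i _.
1,2: rewrite prE // -(prob_etaE x [set k | (i < k)%N]) /=.
1,2: rewrite (prE P (measurable_eta M x [set k | (i < k)%N])) -EFinM lee_fin.
1,2: by rewrite mulrC; exact: hF.
- rewrite (_ : _ `&` _ = \bigcup_i S i n); last first.
    apply/seteqP; split=> w /=.
      by move=> [Hw [[i [ie ai]]|//]]; exists i.
    by move=> [i _ [[Hw ie] ai]]; split=> //; left; exists i.
  apply: main => // i; rewrite prS mulrAC [X in _ <= X]mulrC mulrAC.
  rewrite -!mulrA ler_wpM2l ?pr_ge0 // mulrC ler_wpM2l ?pr_ge0 // lerDl.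
  by apply: sumr_ge0 => m _; rewrite mulr_ge0 // exprn_ge0.
(* With the landing site fixed, [C i m y] is an event on the sites of [x :: A] and serves as the
   past in the induction at [y]. For fixed [i] and [m] these events are disjoint inside [S i m], so
   summing over [y] costs no factor. *)
pose C i m y := S i m `&` [set w | fm_walk M x i m w = y].
pose D i m y := C i m y `&`
  [set w | y \notin x :: A /\ fresh_chain w k (n - m) y (y :: x :: A)].
have mC i m y : measurable (C i m y) by apply: measurableI => //; exact: measurable_walk.
have mD i m y : measurable (D i m y).
  apply: measurableI => //; apply: measurable_and2; first exact: measurable_prop.
  exact: measurable_fresh_chain.
have DC i m y : pr P (D i m y) <= pr P (C i m y) * bound (n - m).
  have [yA|yA] := boolP (y \in x :: A).
    rewrite /D yA (_ : C i m y `&` _ = set0).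
      by rewrite pr0 mulr_ge0 // pr_ge0.
    by apply/seteqP; split=> // w [_ []].
  have cC : cyl (x :: A) (C i m y).
    have [cS _] := cyl_first_step i m xA cH.
    have c2 : cyl (x :: A) [set w | fm_walk M x i m w = y].
      by apply: cylinder_in (@sigma_walkE x i m y); rewrite /= inE eqxx.
    have := cylinderI fm_sigmaI fm_sigmaT cS c2.
    by apply: cylinder_sub => j [].
  apply: le_trans (IH (n - m)%N y (x :: A) _ yA cC).
  apply: le_pr.
  - exact: mD.
  - by apply: measurableI => //; exact: measurable_fresh_chain.
  - by move=> w [Cw [_ h]].
have bigDC i m : pr P (\bigcup_y D i m y) <= pr P (S i m) * bound (n - m).
  rewrite -lee_fin -prE; last exact: countable_bigcupT_measurable (countableP _) (mD i m).
  apply: le_trans (@countable_union_bound _ _ _ P _ (D i m) (C i m) (bound (n - m)) _ _ _ _ _) _ => //.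
  - by move=> y z _ _ [w [[_ <-] [_ <-]]].
  - by move=> y; rewrite !prE // -EFinM lee_fin.
  have h : (P (\bigcup_y C i m y) <= (pr P (S i m))%:E)%E.
    rewrite -(prE P (mS i m)) le_measure // ?inE //; last by move=> w [y _ []].
    exact: countable_bigcupT_measurable (countableP _) (mC i m).
  have b0 : (0 <= (bound (n - m))%:E)%E by rewrite lee_fin.
  exact: (lee_wpmul2r b0 h).
rewrite (_ : _ `&` _ = \bigcup_i (S i n `|` \big[setU/set0]_(m < n) \bigcup_y D i m.+1 y)); last first.
  apply/seteqP; split=> w /=.
    move=> [Hw [[i [ie ai]]|[i [m [y [/andP[/andP[m0 mn] yA] ie ai e c]]]]]]; exists i => //.
      by left.
    right; rewrite -bigcup_seq; have mn' : (m.-1 < n)%N by rewrite prednK.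
    exists (Ordinal mn') => /=; first by rewrite mem_index_enum.
    by rewrite prednK //; exists y.
  move=> [i _ []]; first by move=> [[Hw ie] ai]; split=> //; left; exists i.
  rewrite -bigcup_seq => -[m _ [y _ [[[[Hw ie] ai] e] [yA c]]]]; split=> //.
  by right; exists i, m.+1, y; split=> //; rewrite yA andbT; exact: ltn_ord.
have mU i : measurable (\big[setU/set0]_(m < n) \bigcup_y D i m.+1 y).
  apply: bigsetU_measurable => m _.
  exact: countable_bigcupT_measurable (countableP _) (mD i m.+1).
apply: main => i; first exact: measurableU.
apply: le_trans (prU_le P (mS i n) (mU i)) _.
rewrite prS [X in _ <= X]mulrA [q i * _]mulrC mulrDr lerD2l.
apply: le_trans (pr_bigU_le P _ _) _.
  by move=> m; exact: countable_bigcupT_measurable (countableP _) (mD i m.+1).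
rewrite mulr_sumr; apply: ler_sum => m _.
by apply: le_trans (bigDC i m.+1) _; rewrite prS -mulrA.
Qed.

Lemma proper_start_ae : P (~` [set w | proper_start w]) = 0%E.
Proof.
have h x i : P [set w | fm_walk M x i 0 w <> x] = 0%E.
  have m1 : measurable [set w | fm_walk M x i 0 w = x] by exact: measurable_walk.
  rewrite [X in P X](_ : _ = ~` [set w | fm_walk M x i 0 w = x]) //.
  rewrite probability_setC // (_ : P _ = 1%E) ?subee //.
  have := fm_walk_law M x i 0 (fun=> x); rewrite big_ord0 mulr1 eqxx => <-.
  congr (P _); apply/seteqP; split=> w /=; last exact.
  by move=> e k; rewrite leqn0 => /eqP ->.
have mh (xi : G * nat) : measurable [set w | fm_walk M xi.1 xi.2 0 w <> xi.1].
  by apply: (@measurableC _ _ [set w | fm_walk M xi.1 xi.2 0 w = xi.1]); exact: measurable_walk.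
rewrite [X in P X](_ : _ = \bigcup_xi [set w | fm_walk M xi.1 xi.2 0 w <> xi.1]).
  exact: countable_union0.
apply/seteqP; split=> w /=.
  by move=> /existsNP[x /existsNP[i e]]; exists (x, i).
by move=> [[x i] _ /= e] st; apply: e.
Qed.

Lemma survival_null : p * (1 + a) < 1 -> P (survival M) = 0%E.
Proof.
move=> sub; have mV := measurable_survival M.
have mst0 : measurable [set w : fm_space M | proper_start w].
  apply: measurable_all => x; apply: measurable_all => i; exact: measurable_walk.
have mst : measurable (~` [set w : fm_space M | proper_start w]) by exact: measurableC.
have le_b n : pr P (survival M) <= bound n.
  have mc := measurable_fresh_chain n n root [:: root].
  have cT : cyl [::] setT.
    by exists [::], (fun=> setT); split=> //; rewrite bigcap_seq big_nil.
  have := fresh_chain_bound n n (negbT (in_nil (@root G))) cT.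
  rewrite setTI prT mul1r; apply: le_trans.
  apply: (@le_trans _ _ (pr P (~` [set w | proper_start w] `|`
      [set w | fresh_chain w n n root [:: root]]))).
    apply: le_pr => //; first exact: measurableU.
    move=> w sw; have [st|st] := pselect (proper_start w); [right|by left].
    exact: survival_fresh_chain.
  by apply: le_trans (prU_le P mst mc) _; rewrite /pr proper_start_ae /= add0r.
suff : pr P (survival M) <= 0.
  rewrite prE // => h; congr EFin; apply/le_anti; by rewrite h pr_ge0.
have cv : bound n @[n --> \oo] --> (a * 0 : R).
  apply: cvgMr; apply: cvg_expr; rewrite ger0_norm // mulr_ge0 // addr_ge0 //.
rewrite -[leRHS](mulr0 a) -(cvg_lim _ cv) //.
by apply: limr_ge; [apply/cvg_ex; exists (a * 0) | exact: nearW].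
Qed.

End FirstMoment.

(** * A frog model on the regular tree *)

Section MoreIndependence.
Variable R : realType.

Lemma mutually_independentS d (T : measurableType d) (P : probability T R)
    (J : eqType) (F F' : J -> set_system T) :
  (forall j, F j `<=` F' j) -> mutually_independent P F' ->
  mutually_independent P F.
Proof. by move=> FF' ind s A us sA; apply: ind => // j /sA /FF'. Qed.

Lemma nat_RV d (T : measurableType d) (P : probability T R) (X : T -> nat) :
  (forall k, measurable (X @^-1` [set k])) ->
  {Y : {RV P >-> nat} | Y = X :> (T -> nat)}.
Proof.
move=> mX; have mX' : measurable_fun setT X.
  move=> _ A _; rewrite setTI (_ : X @^-1` A = [set w | exists k, A k /\ X w = k]).
    apply: measurable_ex => k; apply: measurable_and2; first exact: measurable_prop.
    exact: mX.
  by apply/seteqP; split=> w /=; [exists (X w) | case=> k [? ->]].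
pose Y : {mfun T >-> nat} := HB.pack X (isMeasurableFun.Build _ _ _ _ X mX').
by exists Y.
Qed.

Lemma is_pmf_law d (T : measurableType d) (P : probability T R)
  (X : {RV P >-> nat}) : is_pmf (fun k => pr P (X @^-1` [set k])).
Proof.
have mX k : measurable (X @^-1` [set k]).
  by rewrite -[X in measurable X]setTI; exact: (measurable_funPT X).
split=> [k|]; first exact: pr_ge0.
have s1 : (\sum_(0 <= k <oo) P (X @^-1` [set k]) = 1)%E.
  rewrite -(probability_setT P) -measure_semi_bigcup //.
  - by congr (P _); apply/seteqP; split=> // w _; exists (X w).
  - by move=> k l _ _ [w [<- <-]].
  - exact: bigcup_measurable.
have cv : (\sum_(0 <= k < n) P (X @^-1` [set k]))%E @[n --> \oo] --> 1%E.
  by rewrite -s1; apply: is_cvg_nneseries.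
have -> : partial_sum (fun k => pr P (X @^-1` [set k])) =
    fine \o (fun n => \sum_(0 <= k < n) P (X @^-1` [set k]))%E.
  by apply/funext => n /=; rewrite -sum_fine // => k _; exact: fin_num_measure.
exact: fine_cvg cv.
Qed.

Lemma is_pmf_lifetime (p : R) : 0 <= p < 1 ->
  is_pmf (fun k => lifetime_pmf p (Some k)).
Proof.
move=> /andP[p0 p1]; split=> [[|k]|] //=.
  by rewrite mulr_ge0 ?exprn_ge0 // subr_ge0 ltW.
rewrite -cvg_shiftS /=; under eq_fun do
  rewrite /partial_sum big_nat_recl //= add0r geometric_partial_sum.
have : (1 - p ^+ n) @[n --> \oo] --> (1 - 0 : R).
  by apply: cvgB; [exact: cvg_cst | apply: cvg_expr; rewrite ger0_norm].
by rewrite subr0.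
Qed.

Lemma is_pmf_uniform n : is_pmf (fun k => (k < n.+1)%:R / n.+1%:R : R).
Proof.
split=> [k|]; first by rewrite divr_ge0.
apply: cvg_near_cst; exists n.+1 => // m /= nm.
rewrite /partial_sum (big_cat_nat (leq0n n.+1) nm) //= [X in _ + X]big_nat_cond.
rewrite [X in _ + X]big1 ?addr0; last first.
  by move=> i; rewrite andbT => /andP[ni _]; rewrite ltnNge ni mul0r.
rewrite big_nat (eq_bigr (fun=> n.+1%:R^-1)) -?big_nat.
  by rewrite sumr_const_nat subn0 -[LHS]mulr_natr mulVf // pnatr_eq0.
by move=> i /= ->; rewrite mul1r.
Qed.

End MoreIndependence.

(** * A realization on the tree whose walks are driven by independent edge labels *)

Section TreeModel.
Variables (R : realType) (d : nat) (p : R) (d0 : measure_display).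
Variables (T0 : measurableType d0) (P0 : probability T0 R).
Variables (eta : {RV P0 >-> nat}).
Hypothesis p01 : 0 <= p < 1.
Local Notation G := (regular_tree d.+1).
(* inl x stands for eta(x), inr (inl (x, i)) for the lifetime of the i-th particle
   of x and inr (inr (x, i, n)) for the label of the edge it crosses at step n. *)
Local Notation E := (G + (G * nat + G * nat * nat))%type.

Definition elementary_pmf (j : E) : nat -> R :=
  match j with
  | inl _ => fun k => pr P0 (eta @^-1` [set k])
  | inr (inl _) => fun k => lifetime_pmf p (Some k)
  | inr (inr _) => fun k => (k < d.+1)%:R / d.+1%:R
  end.

(** Independence is refined from whole walks, as in [fm_independent], to single steps: each label
    has its own sigma-algebra. *)
Record labelled_model := LabelledModel {
  lm_model :> frog_model G p eta;
  lm_label : G -> nat -> nat -> fm_space lm_model -> 'I_d.+1;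
  lm_sigma : E -> set_system (fm_space lm_model);
  lm_walk0 : forall x i w, fm_walk lm_model x i 0 w = x;
  lm_walkS : forall x i n w, fm_walk lm_model x i n.+1 w =
    toggle (lm_label x i n w) (fm_walk lm_model x i n w);
  lm_sub : forall j, lm_sigma j `<=` measurable;
  lm_algebra : forall j, sigma_algebra setT (lm_sigma j);
  lm_independent : mutually_independent (fm_prob lm_model) lm_sigma;
  lm_sigma_eta : forall x k,
    lm_sigma (inl x) (fm_eta lm_model x @^-1` [set k]);
  lm_sigma_life : forall x i (k : option nat),
    lm_sigma (inr (inl (x, i))) (fm_life lm_model x i @^-1` [set k]);
  lm_sigma_label : forall x i n l,
    lm_sigma (inr (inr (x, i, n))) (lm_label x i n @^-1` [set l]);
  lm_label_law : forall x i n l,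
    fm_prob lm_model (lm_label x i n @^-1` [set l]) = (d.+1%:R^-1 : R)%:E
}.

Section Construction.
Variable X : E -> measurableTypeR R -> nat.
Local Notation P := (@unit_measure R).
Hypothesis mX : forall j k, measurable (X j @^-1` [set k]).
Hypothesis XE : forall j k, P (X j @^-1` [set k]) = (elementary_pmf j k)%:E.
Hypothesis indX : mutually_independent P (fun j => point_events (X j)).

Let F j := point_events (X j).

Let mF j : F j `<=` measurable.
Proof. by move=> A [->|->|[k ->]]. Qed.

Let FT j : F j setT. Proof. exact: Or31. Qed.

Let FI j : setI_closed (F j). Proof. exact: point_events_setI. Qed.

Let S j := sigma_block F [set j].

Let S_point j (A : set nat) : S j (X j @^-1` A).
Proof.
pose U := g_sigma_algebraType [set B | exists2 j', [set j] j' & F j' B].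
suff : measurable (X j @^-1` A : set U) by [].
rewrite [X in measurable X](_ : _ = [set w | exists k, A k /\ X j w = k]).
  apply: measurable_ex => k; apply: measurable_and2; first exact: measurable_prop.
  by apply: sub_sigma_algebra; exists j => //; apply: Or33; exists k.
by apply/seteqP; split=> w /=; [exists (X j w) | case=> k [? ->]].
Qed.

Let mXA j (A : set nat) : measurable (X j @^-1` A).
Proof. exact: (sigma_block_measurable mF (S_point A)). Qed.

Definition tree_eta (x : G) : {RV P >-> nat} := sval (nat_RV P (mX (inl x))).

Let tree_etaE x : tree_eta x = X (inl x) :> (_ -> nat).
Proof. exact: (svalP (nat_RV P (mX (inl x)))). Qed.

Definition tree_life (x : G) i w := Some (X (inr (inl (x, i))) w).

Definition tree_label (x : G) i n w : 'I_d.+1 := inord (X (inr (inr (x, i, n))) w).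

Fixpoint tree_walk (x : G) i n w : G :=
  if n is n'.+1 then toggle (tree_label x i n' w) (tree_walk x i n' w) else x.

Let S_label x i n l : S (inr (inr (x, i, n))) (tree_label x i n @^-1` [set l]).
Proof. exact: (@S_point _ [set k | inord k = l]). Qed.

Let m_label x i n l : measurable (tree_label x i n @^-1` [set l]).
Proof. exact: (@mXA _ [set k | inord k = l]). Qed.

(* inord sends the values above d, which have probability 0, to 0: each fiber has
   probability at least 1/(d+1), and these probabilities sum to 1. *)
Let label_law x i n l : P (tree_label x i n @^-1` [set l]) = (d.+1%:R^-1 : R)%:E.
Proof.
have ge k : d.+1%:R^-1 <= pr P (tree_label x i n @^-1` [set k]).
  rewrite -lee_fin -prE //.
  have <- : P (X (inr (inr (x, i, n))) @^-1` [set (k : nat)]) = (d.+1%:R^-1)%:E.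
    by rewrite XE /= ltn_ord mul1r.
  rewrite le_measure ?inE // => w /= Xk; rewrite /tree_label Xk; exact: inord_val.
have := pr_total P (m_label x i n) measurableT.
rewrite prT; under eq_bigr do rewrite setIT.
rewrite (prE P (m_label x i n l)) => s1; congr EFin; apply/le_anti.
rewrite ge andbT -subr_le0.
have : \sum_k (pr P (tree_label x i n @^-1` [set k]) - d.+1%:R^-1) = 0.
  by rewrite sumrB -s1 sumr_const card_ord -[X in _ - X]mulr_natr mulVf ?pnatr_eq0 // subrr.
move=> s0; rewrite -[leRHS]s0 (bigD1 l) //= lerDl sumr_ge0 // => k _.
by rewrite subr_ge0.
Qed.

Let S_independent : mutually_independent P S.
Proof.
apply: (@blocks_independent _ _ _ _ _ F mF FI FT indX _ (fun k => [set k])).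
by move=> k k' j /= -> ->.
Qed.

Let walk_block x i : set E := [set j | exists n, j = inr (inr (x, i, n))].

Let walk_sigma x i n y : sigma_block F (walk_block x i) (tree_walk x i n @^-1` [set y]).
Proof.
pose U := g_sigma_algebraType [set A | exists2 j, walk_block x i j & F j A].
suff : measurable (tree_walk x i n @^-1` [set y] : set U) by [].
elim: n y => [|n IH] y; first exact: (@measurable_prop _ U (x = y)).
rewrite [X in measurable X](_ : _ = [set w | exists l, tree_label x i n w = l /\
    tree_walk x i n w = toggle l y]).
  apply: measurable_ex => l; apply: measurable_and2; last exact: IH.
  by apply: sigma_block_sub (@S_label x i n l) => j /= ->; exists n.
apply/seteqP; split=> w /=; first by move=> <-; exists (tree_label x i n w); rewrite toggleK.
by move=> [l [-> ->]]; rewrite toggleK.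
Qed.

Let walk_measurable x i n y : measurable (tree_walk x i n @^-1` [set y]).
Proof. exact: (sigma_block_measurable mF (@walk_sigma x i n y)). Qed.

Let walk_law x i n (y : nat -> G) :
  P [set w | forall k, (k <= n)%N -> tree_walk x i k w = y k] =
    ((y 0%N == x)%:R * \prod_(k < n) srw_step R (y k) (y k.+1))%:E.
Proof.
have [y0|y0] := eqVneq (y 0%N) x; last first.
  rewrite mul0r (_ : [set w | _] = set0) ?measure0 //.
  by apply/seteqP; split=> // w /(_ 0%N isT) /= e; rewrite -e eqxx in y0.
rewrite mul1r.
(* Along a path of the tree the event prescribes [n] labels, which are independent and uniform; if
   some step is not an edge, both sides vanish. *)
have [adj|nadj] := pselect (forall k, (k < n)%N -> exists l, y k.+1 = toggle l (y k)).
  have /choice[l yl] k : exists l, (k < n)%N -> y k.+1 = toggle l (y k).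
    have [/adj[l ?]|_] := boolP (k < n)%N; first by exists l.
    by exists ord0.
  have -> : \prod_(k < n) srw_step R (y k) (y k.+1) = \prod_(k < n) (d.+1%:R^-1 : R).
    apply: eq_bigr => k _; rewrite /srw_step regular_tree_degree.
    suff -> : y k.+1 \in nbrs (y k) by rewrite mul1r.
    by apply/tree_nbrsP; exists (l k); exact: yl.
  pose j k : E := inr (inr (x, i, k)).
  pose A (e : E) : set (measurableTypeR R) :=
    if e is inr (inr (_, k)) then tree_label x i k @^-1` [set l k] else setT.
  have -> : [set w | forall k, (k <= n)%N -> tree_walk x i k w = y k] =
      \big[setI/setT]_(e <- [seq j k | k <- iota 0 n]) A e.
    rewrite big_map -bigcap_seq; apply/seteqP; split=> w.
      move=> h k; rewrite /mkset mem_iota => kn /=.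
      apply: (@toggle_injl _ (y k)); rewrite -yl // -(h k.+1) //= h //.
      exact: ltnW.
    move=> h k; elim: k => [|k IH] kn /=; first by rewrite y0.
    rewrite IH ?(ltnW kn) // yl //; congr (toggle _ _).
    by apply: (h k); rewrite /mkset mem_iota.
  rewrite S_independent.
  - rewrite big_map -prodEFin -[n in RHS]subn0 -(big_mkord xpredT (fun=> (d.+1%:R^-1 : R)%:E)).
    by rewrite /index_iota !subn0; apply: eq_bigr => k _; exact: label_law.
  - by rewrite map_inj_uniq ?iota_uniq // => k k' [].
  - by move=> e /mapP[k _ ->]; exact: S_label.
have [k kn nk] : exists2 k, (k < n)%N & forall l, y k.+1 <> toggle l (y k).
  apply: contrapT => h; apply: nadj => k kn; apply: contrapT => h'.
  by apply: h; exists k => // l e; apply: h'; exists l.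
rewrite (bigD1 (Ordinal kn)) //= {1}/srw_step.
rewrite (_ : (y k.+1 \in nbrs (y k)) = false) ?mul0r; last first.
  by apply/negP => /tree_nbrsP[l] /nk.
rewrite (_ : [set w | _] = set0) ?mul0r ?measure0 //.
apply/seteqP; split=> // w h; apply: (nk (tree_label x i k w)).
by rewrite -(h k.+1) //= h // ltnW.
Qed.

Let life_measurable x i k : measurable (tree_life x i @^-1` [set k]).
Proof. exact: (@mXA _ [set l | Some l = k]). Qed.

Let life_law x i k : P (tree_life x i @^-1` [set k]) = (lifetime_pmf p k)%:E.
Proof.
case: k => [k|].
  rewrite -(XE (inr (inl (x, i))) k); congr (P _).
  by apply/seteqP; split=> w; rewrite /tree_life /=; [case | move=> ->].
rewrite (_ : _ @^-1` _ = set0) ?measure0 /=; last by apply/seteqP; split.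
by case/andP: p01 => _ /lt_eqF ->.
Qed.

Let model_block (j : G + (G * nat + G * nat)) : set E :=
  match j with
  | inl x => [set inl x]
  | inr (inl (x, i)) => walk_block x i
  | inr (inr (x, i)) => [set inr (inl (x, i))]
  end.

Let model_independent : mutually_independent P
    (fun j : G + (G * nat + G * nat) =>
       match j with
       | inl x => <<s [set A | exists k, A = tree_eta x @^-1` [set k]] >>
       | inr (inl (x, i)) =>
           <<s [set A | exists n y, A = tree_walk x i n @^-1` [set y]] >>
       | inr (inr (x, i)) =>
           <<s [set A | exists k : option nat, A = tree_life x i @^-1` [set k]] >>
       end).
Proof.
have ind := @blocks_independent _ _ _ _ _ F mF FI FT indX _ model_block.
apply: mutually_independentS (ind _).
  move=> [x|[[x i]|[x i]]]; apply: smallest_sub; try exact: smallest_sigma_algebra.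
  - by move=> A [k ->]; rewrite tree_etaE; exact: S_point.
  - by move=> A [n [y ->]]; exact: walk_sigma.
  - by move=> A [k ->]; exact: (@S_point _ [set l | Some l = k]).
move=> [x|[[x i]|[x i]]] [x'|[[x' i']|[x' i']]] j /=.
- by move=> -> [->].
- by move=> -> [].
- by move=> ->.
- by move=> [n ->].
- by move=> [n ->] [n' [-> ->]].
- by move=> [n ->].
- by move=> ->.
- by move=> -> [].
- by move=> -> [-> ->].
Qed.

Let eta_law x k :
  P (tree_eta x @^-1` [set k]) = P0 (eta @^-1` [set k]).
Proof.
rewrite tree_etaE XE /= -prE //.
by rewrite -[X in measurable X]setTI; exact: (measurable_funPT eta).
Qed.

Lemma labelled_model_of_family : inhabited labelled_model.
Proof.
pose M : frog_model G p eta := @FrogModel R G p d0 T0 P0 eta _ _ P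
  tree_eta tree_walk tree_life eta_law
  walk_measurable walk_law life_measurable life_law model_independent.
split; apply: (@LabelledModel M tree_label S) => //.
- by move=> j; exact: sigma_block_measurable.
- by move=> j; exact: smallest_sigma_algebra.
- by move=> x k; rewrite /= tree_etaE; exact: S_point.
- by move=> x i k; exact: (@S_point _ [set l | Some l = k]).
Qed.

End Construction.

Theorem labelled_model_exists : inhabited labelled_model.
Proof.
have pmf j : is_pmf (elementary_pmf j).
  case: j => [x|[[x i]|[[x i] n]]] /=; first exact: is_pmf_law.
    exact: is_pmf_lifetime.
  exact: is_pmf_uniform.
have [X [mX XE indX]] := independent_family pmf.
exact: (labelled_model_of_family mX XE indX).
Qed.

End TreeModel.

(** * Rays of the regular tree *)

Section Bonferroni.
Variable R : realType.

(** It makes the chance that one of [k] independent trials succeeds linear in [k], up to a quadratic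
    error, so that only the mean of [k] enters the main term. *)
Lemma expr_onem_le (e : R) k : 0 <= e <= 1 ->
  (1 - e) ^+ k <= 1 - k%:R * e + (k%:R * e) ^+ 2.
Proof.
move=> /andP[e0 e1]; elim: k => [|k IH].
  by rewrite expr0 mul0r subr0 expr0n addr0.
rewrite exprS; apply: le_trans (ler_wpM2l _ IH) _; first by rewrite subr_ge0.
rewrite -subr_ge0; set K := k%:R.
have K0 : 0 <= K by exact: ler0n.
have -> : k.+1%:R = K + 1 :> R by rewrite -natr1.
have -> : 1 - (K + 1) * e + ((K + 1) * e) ^+ 2 - (1 - e) * (1 - K * e + (K * e) ^+ 2) =
   K * e ^+ 2 + e ^+ 2 + K ^+ 2 * e ^+ 3 by ring.
by rewrite !addr_ge0 ?mulr_ge0 ?exprn_ge0.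
Qed.

Lemma pr_independent d (T : measurableType d) (P : probability T R)
    (J : choiceType) (F : J -> set_system T) s (A : J -> set T) :
  mutually_independent P F -> (forall j, F j `<=` measurable) -> uniq s ->
  (forall j, j \in s -> F j (A j)) ->
  pr P (\bigcap_(j in [set` s]) A j) = \prod_(j <- s) pr P (A j).
Proof.
move=> ind mF us sA; apply: EFin_inj; rewrite -prE; last first.
  by apply: fin_bigcap_measurable => // j /sA /mF.
rewrite bigcap_seq ind // -prodEFin big_seq [RHS]big_seq.
by apply: eq_bigr => j /sA /mF mA; rewrite -prE.
Qed.

End Bonferroni.

Section Words.
Variable d : nat.
Local Notation G := (regular_tree d.+1).
Implicit Types (x y z : G) (f : 'I_d.+1) (g : nat -> 'I_d.+1).

(* The descendants of y that do not descend from its child along the edge f;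
   reversed words list the labels from the root. *)
Definition subtree y f : set G :=
  [set z | prefix (rev (sval y)) (rev (sval z)) &&
           ~~ prefix (rcons (rev (sval y)) f) (rev (sval z))].

Lemma subtree_root y f : subtree y f y.
Proof.
rewrite /subtree /mkset prefix_refl /=; apply/negP => /size_prefix.
by rewrite size_rcons ltnn.
Qed.

Fixpoint follow x g m : G :=
  if m is m'.+1 then toggle (g m') (follow x g m') else x.

(** The head of a word labels the edge to its parent, so under these conditions no toggle cancels a
    letter and the walk moves away from the root at every step. *)
Lemma follow_rev x g m : ohead (sval x) != Some (g 0%N) ->
  (forall n, (n.+1 < m)%N -> g n != g n.+1) ->
  rev (sval (follow x g m)) = rev (sval x) ++ mkseq g m.
Proof.
move=> h0; elim: m => [|m IH] h; first by rewrite cats0.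
have {}IH := IH (fun n nm => h n (ltnW nm)).
have -> : sval (follow x g m.+1) = g m :: sval (follow x g m).
  rewrite /= /toggle_seq; move: IH h; case: m => [|m] IH h.
    by move: h0 => /=; case: (sval x) => [//|a s] /=; case: (eqVneq (g 0%N) a) => [->|]; rewrite ?eqxx.
  have -> : sval (follow x g m.+1) = g m :: behead (sval (follow x g m.+1)).
    rewrite -[LHS]revK IH mkseqS -rcons_cat rev_rcons /=; congr (_ :: _).
    by rewrite -[X in behead X]revK IH mkseqS -rcons_cat rev_rcons.
  have := h m (ltnSn _); by rewrite eq_sym => /negPf ->.
by rewrite rev_cons IH mkseqS -rcons_cat.
Qed.

Lemma prefix_mkseq (T : eqType) (h : nat -> T) m n : (m <= n)%N ->
  prefix (mkseq h m) (mkseq h n).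
Proof.
move=> mn; rewrite prefixE size_mkseq /mkseq -map_take take_iota.
by rewrite (minn_idPl mn).
Qed.

Section Rays.
Variables (K L : nat) (x : G) (f : 'I_d.+1).
Variable c : {ffun 'I_K * 'I_L.+1 -> 'I_d.+1}.
Implicit Types u v : 'I_K * 'I_L.

Definition ray (i : 'I_K) (n : nat) : 'I_d.+1 := c (i, inord n).

Definition ray_site u : G := follow x (ray u.1) u.2.+1.

(** The label following the one that leads to [ray_site u]. At the last site of a ray it is label
    [L], counted from 0, which is why [L.+1] labels serve [L] jumps. *)
Definition ray_exit u : 'I_d.+1 := ray u.1 u.2.+1.

Definition good_labels : bool := injectiveb c &&
  [forall v, (c v != f) && (ohead (sval x) != Some (c v))].

Hypothesis good : good_labels.

Let c_inj : injective c. Proof. by case/andP: good => /injectiveP. Qed.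

Let ray_inj i i' n n' : (n <= L)%N -> (n' <= L)%N -> ray i n = ray i' n' ->
  i = i' /\ n = n'.
Proof.
move=> nL nL' /c_inj[-> /(congr1 val)] /=; rewrite !inordK //.
Qed.

Let rev_follow i m : (m <= L.+1)%N ->
  rev (sval (follow x (ray i) m)) = rev (sval x) ++ mkseq (ray i) m.
Proof.
move=> mL; apply: follow_rev.
  by case/andP: good => _ /forallP /(_ (i, inord 0)) /andP[].
move=> n nm; apply/eqP => /ray_inj [||_ /n_Sn] //.
  by rewrite -ltnS ltnW // (leq_trans nm).
by rewrite -ltnS (leq_trans nm).
Qed.

Lemma size_ray_site u : size (sval (ray_site u)) = (size (sval x) + u.2.+1)%N.
Proof.
by rewrite -size_rev rev_follow ?size_cat ?size_rev ?size_mkseq // ltnS ltnW.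
Qed.

Lemma ray_subtreeE u z : subtree (ray_site u) (ray_exit u) z <->
  exists t, [/\ rev (sval z) = rev (sval x) ++ t, prefix (mkseq (ray u.1) u.2.+1) t
    & ~~ prefix (mkseq (ray u.1) u.2.+2) t].
Proof.
rewrite /subtree /mkset rev_follow; last by rewrite ltnS ltnW.
rewrite rcons_cat /ray_exit -mkseqS; split.
  move=> /andP[/prefixP[t ->]]; rewrite -catA prefix_catr // ?eqxx /= => h.
  by exists (mkseq (ray u.1) u.2.+1 ++ t); rewrite prefix_prefix.
by move=> [t [-> h1 h2]]; rewrite !prefix_catr // ?eqxx /= h1 h2.
Qed.

Lemma ray_subtree_sub u : subtree (ray_site u) (ray_exit u) `<=` subtree x f.
Proof.
move=> z /ray_subtreeE[t [zt h _]]; rewrite /subtree /mkset zt prefix_prefix /=.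
rewrite -cats1 prefix_catr // ?eqxx /=.
move/prefixP: h => [t' ->]; rewrite /mkseq /= prefix0s andbT.
by case/andP: good => _ /forallP /(_ (u.1, inord 0)) /andP[+ _]; rewrite eq_sym.
Qed.

Lemma ray_subtree_x u : ~ subtree (ray_site u) (ray_exit u) x.
Proof.
move=> /ray_subtreeE[t [/(congr1 size)]]; rewrite size_cat => e.
have : size t = 0%N by apply/eqP; rewrite -(eqn_add2l (size (rev (sval x)))) -e addn0.
by move=> /size0nil ->.
Qed.

(** A common descendant determines the first label, hence the particle, as all labels differ. On a
    single ray, descendants of the deeper site lie beyond the exit edge of the shallower one. *)
Lemma ray_subtree_disj u v z : subtree (ray_site u) (ray_exit u) z ->
  subtree (ray_site v) (ray_exit v) z -> u = v.
Proof.
move=> /ray_subtreeE[t [zt pu nu]] /ray_subtreeE[t' [zt' pv nv]].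
have tt : t' = t by move: zt; rewrite zt' => /eqP; rewrite eqseq_cat // eqxx /= => /eqP.
subst t'.
have e1 : u.1 = v.1.
  have : ray u.1 0 = ray v.1 0.
    by move/prefixP: pu => [s ->] in pv *; move/prefixP: pv => [s' []].
  by move=> /ray_inj[].
case: u v e1 pu nu pv nv => i m [i' m'] /= <- pu nu pv nv.
congr pair; apply/val_inj/eqP; rewrite eqn_leq; apply/andP; split.
  rewrite leqNgt; apply/negP => lt; move/negP: nv; apply.
  by apply: prefix_trans pu; exact: prefix_mkseq.
rewrite leqNgt; apply/negP => lt; move/negP: nu; apply.
by apply: prefix_trans pv; exact: prefix_mkseq.
Qed.

End Rays.
End Words.

(** * The exploration process *)

Section Survival.
Variables (R : realType) (d : nat) (p : R) (d0 : measure_display).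
Variables (T0 : measurableType d0) (P0 : probability T0 R).
Variables (eta : {RV P0 >-> nat}) (M : labelled_model d p eta).
Local Notation G := (regular_tree d.+1).
Local Notation E := (G + (G * nat + G * nat * nat))%type.
Local Notation P := (fm_prob M).
Local Notation F := (@lm_sigma _ _ _ _ _ _ _ M).
Local Notation lab := (@lm_label _ _ _ _ _ _ _ M).
Implicit Types (w : fm_space M) (x y z : G) (f : 'I_d.+1).
Variables K L : nat.
Implicit Type v : 'I_K * 'I_L.

Let FT j : F j setT.
Proof. by have [F0 FD _] := lm_algebra M j; rewrite -(setD0 setT); exact: FD. Qed.

Let FI j : setI_closed (F j).
Proof.
move=> A B FA FB; have [F0 FD FU] := lm_algebra M j.
have -> : A `&` B = setT `\` \bigcup_n bigcup2 (setT `\` A) (setT `\` B) n.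
  by rewrite bigcup2E !setTD setCU !setCK.
apply: (FD); apply: FU => -[|[|n]] //=; exact: FD.
Qed.

Definition index_site (j : E) : G :=
  match j with
  | inl x => x
  | inr (inl (x, _)) => x
  | inr (inr (x, _, _)) => x
  end.

Definition site_block (W : set G) : set E := [set j | W (index_site j)].

Definition local_labels x w : {ffun 'I_K * 'I_L.+1 -> 'I_d.+1} :=
  [ffun v : 'I_K * 'I_L.+1 => lab x v.1 v.2 w].

Definition local_alive x w : {set 'I_K * 'I_L} :=
  [set v : 'I_K * 'I_L | (v.1 < fm_eta M x w)%N && alive (fm_life M x v.1 w) v.2.+1].

(* The exploration from x with forbidden edge f reaches n generations. *)
Fixpoint explores n x f w : Prop :=
  if n is n'.+1 then good_labels x f (local_labels x w) /\
    exists v, v \in local_alive x w /\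
      explores n' (ray_site x (local_labels x w) v) (ray_exit (local_labels x w) v) w
  else True.

Lemma ray_site_walk x w v :
  ray_site x (local_labels x w) v = fm_walk M x v.1 v.2.+1 w.
Proof.
rewrite /ray_site; have := ltn_ord v.2; move: (nat_of_ord v.2) => m mL.
have {mL} : (m.+1 <= L.+1)%N by rewrite ltnS ltnW.
elim: m.+1 => [|k IH] kL /=; first by rewrite lm_walk0.
by rewrite lm_walkS IH ?(ltnW kL) // /ray ffunE /= inordK.
Qed.

Definition label_block x : set E := [set j | exists i n, j = inr (inr (x, i, n))].

Definition life_block x : set E :=
  [set j | j = inl x \/ exists i, j = inr (inl (x, i))].

Lemma sigma_labels x c : sigma_block F (label_block x) (local_labels x @^-1` [set c]).
Proof.
pose U := g_sigma_algebraType [set A | exists2 j, label_block x j & F j A].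
suff : measurable (local_labels x @^-1` [set c] : set U) by [].
rewrite [X in measurable X](_ : _ = [set w | forall v : 'I_K * 'I_L.+1, lab x v.1 v.2 w = c v]).
  apply: measurable_all => v; apply: sub_sigma_algebra.
  exists (inr (inr (x, nat_of_ord v.1, nat_of_ord v.2))); first by exists v.1, v.2.
  exact: lm_sigma_label.
apply/seteqP; split=> w /=; first by move=> <- v; rewrite ffunE.
by move=> h; apply/ffunP => v; rewrite ffunE.
Qed.

Lemma sigma_alive_mem x v : sigma_block F (life_block x)
  [set w | (v.1 < fm_eta M x w)%N && alive (fm_life M x v.1 w) v.2.+1].
Proof.
pose U := g_sigma_algebraType [set A | exists2 j, life_block x j & F j A].
suff : measurable ([set w | (v.1 < fm_eta M x w)%N &&
  alive (fm_life M x v.1 w) v.2.+1] : set U) by [].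
rewrite [X in measurable X](_ : _ =
    [set w | (exists k, (v.1 < k)%N /\ fm_eta M x w = k) /\
             exists l : option nat, alive l v.2.+1 /\ fm_life M x v.1 w = l]).
  apply: measurable_and2.
    apply: measurable_ex => k; apply: measurable_and2; first exact: measurable_prop.
    apply: sub_sigma_algebra; exists (inl x); first by left.
    exact: lm_sigma_eta.
  apply: measurable_ex => l; apply: measurable_and2; first exact: measurable_prop.
  apply: sub_sigma_algebra; exists (inr (inl (x, nat_of_ord v.1))).
    by right; exists v.1.
  exact: lm_sigma_life.
apply/seteqP; split=> w /=.
  by move=> /andP[? ?]; split; [exists (fm_eta M x w) | exists (fm_life M x v.1 w)].
by move=> [[k [vk ->]] [l [al ->]]]; rewrite vk.
Qed.

Lemma sigma_alive x D : sigma_block F (life_block x) (local_alive x @^-1` [set D]).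
Proof.
pose U := g_sigma_algebraType [set A | exists2 j, life_block x j & F j A].
suff : measurable (local_alive x @^-1` [set D] : set U) by [].
pose ev w v := (v.1 < fm_eta M x w)%N && alive (fm_life M x v.1 w) v.2.+1.
rewrite [X in measurable X](_ : _ = [set w | forall v, ev w v = (v \in D)]).
  apply: measurable_all => v; have [vD|vD] := boolP (v \in D).
    exact: sigma_alive_mem.
  rewrite [X in measurable X](_ : _ = ~` [set w | ev w v]).
    by apply: measurableC; exact: sigma_alive_mem.
  by apply/seteqP; split=> w /=; [move=> -> | move/negP/negPf].
apply/seteqP; split=> w /=; first by move=> <- v; rewrite inE.
by move=> h; apply/setP => v; rewrite inE; exact: h.
Qed.

(** By induction the exploration looks only at variables of sites in [subtree x f], since the
    subtrees of the ray sites are contained in it. *)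
Lemma sigma_explores n x f :
  sigma_block F (site_block (subtree x f)) (explores n x f).
Proof.
elim: n x f => [|n IH] x f.
  pose U := g_sigma_algebraType [set A | exists2 j, site_block (subtree x f) j & F j A].
  exact: (@measurable_prop _ U True).
pose U := g_sigma_algebraType [set A | exists2 j, site_block (subtree x f) j & F j A].
suff : measurable (explores n.+1 x f : set U) by [].
(* Splitting over the value [c] of the labels makes the ray sites deterministic, so that the
   induction hypothesis applies to them. *)
rewrite [X in measurable X](_ : _ = [set w | exists c,
  good_labels x f c /\ (local_labels x w = c /\
    exists v, ((v.1 < fm_eta M x w)%N && alive (fm_life M x v.1 w) v.2.+1) /\
      explores n (ray_site x c v) (ray_exit c v) w)]); last first.
  apply/seteqP; split=> w /=.
    move=> [g [v [va e]]]; exists (local_labels x w); split=> //; split=> //.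
    by exists v; rewrite inE in va.
  move=> [c [g [cE [v [va e]]]]]; subst c; split=> //; exists v.
  by rewrite inE.
have sx := @subtree_root d x f.
apply: measurable_ex => c; have [g|ng] := boolP (good_labels x f c); last first.
  rewrite [X in measurable X](_ : _ = set0) //.
  by apply/seteqP; split=> // w [].
apply: measurable_and2; first exact: measurable_prop.
apply: measurable_and2.
  by apply: sigma_block_sub (@sigma_labels x c) => j [i [k ->]].
apply: measurable_ex => v; apply: measurable_and2.
  by apply: sigma_block_sub (@sigma_alive_mem x v) => j [->|[i ->]].
apply: sigma_block_sub (IH _ _) => j; exact: ray_subtree_sub.
Qed.

Let mF j : F j `<=` measurable. Proof. exact: lm_sub. Qed.

Let m_block W A : sigma_block F W A -> measurable A.
Proof. exact: sigma_block_measurable. Qed.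

Let m_explores n x f : measurable (explores n x f).
Proof. exact: m_block (@sigma_explores n x f). Qed.

Let m_labels x c : measurable (local_labels x @^-1` [set c]).
Proof. exact: m_block (@sigma_labels x c). Qed.

Let m_alive x D : measurable (local_alive x @^-1` [set D]).
Proof. exact: m_block (@sigma_alive x D). Qed.

(** * One generation of the exploration *)

Section OneStep.
Variables (n : nat) (x : G) (f : 'I_d.+1) (c : {ffun 'I_K * 'I_L.+1 -> 'I_d.+1}).
Hypothesis good : good_labels x f c.
Variable D : {set 'I_K * 'I_L}.

Let blk (k : bool + 'I_K * 'I_L) : set E :=
  match k with
  | inl true => label_block x
  | inl false => life_block x
  | inr v => site_block (subtree (ray_site x c v) (ray_exit c v))
  end.

Let blk_disj k k' j : blk k j -> blk k' j -> k = k'.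
Proof.
have nx v : ~ subtree (ray_site x c v) (ray_exit c v) x := @ray_subtree_x _ _ _ _ _ _ good v.
case: k k' => [[]|v] [[]|v'] //=.
- by move=> [i [m ->]] [|[i']].
- by move=> [i [m ->]] /nx.
- by move=> [->|[i ->]] [i' [m]].
- by move=> [->|[i ->]] /nx.
- by move=> + [i [m e]]; rewrite e => /nx.
- by move=> + [e|[i e]]; rewrite e => /nx.
- by move=> h h'; congr inr; exact: ray_subtree_disj good _ _ _ h h'.
Qed.

Let event (k : bool + 'I_K * 'I_L) : set (fm_space M) :=
  match k with
  | inl true => local_labels x @^-1` [set c]
  | inl false => local_alive x @^-1` [set D]
  | inr v => ~` explores n (ray_site x c v) (ray_exit c v)
  end.

Let sigma_event k : sigma_block F (blk k) (event k).
Proof.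
case: k => [[]|v]; [exact: sigma_labels | exact: sigma_alive|].
have [_ + _] := smallest_sigma_algebra setT [set A | exists2 j, blk (inr v) j & F j A].
by move=> /(_ _ (@sigma_explores n (ray_site x c v) (ray_exit c v))); rewrite setTD.
Qed.

Let pr_events s : uniq s ->
  pr P (\bigcap_(k in [set` s]) event k) = \prod_(k <- s) pr P (event k).
Proof.
move=> us; apply: (@pr_independent _ _ _ P _ (fun k => sigma_block F (blk k))) => //.
- apply: blocks_independent blk_disj; [exact: mF | exact: FI | exact: FT|].
  exact: lm_independent.
- by move=> k; exact: sigma_block_measurable.
Qed.

(** The labels of [x], its particle numbers and lifetimes, and the explorations from the ray sites
    live on disjoint blocks. Given [c] and [D], all the explorations from [D] thus fail with
    probability at most [(1 - e) ^+ #|D|], to which [expr_onem_le] applies. *)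
Lemma one_step_bound (e : R) : 0 <= e <= 1 ->
  (forall y f', e <= pr P (explores n y f')) ->
  pr P (local_labels x @^-1` [set c]) * pr P (local_alive x @^-1` [set D]) *
    (#|D|%:R * e - (#|D|%:R * e) ^+ 2) <=
  pr P ((fun w => (local_labels x w, local_alive x w)) @^-1` [set (c, D)] `&`
        explores n.+1 x f).
Proof.
move=> e01 IH; set a := pr P _; set b := pr P (local_alive x @^-1` _).
have m_event k : measurable (event k) by exact: (sigma_block_measurable mF (@sigma_event k)).
pose s0 : seq (bool + 'I_K * 'I_L) := [:: inl true; inl false].
pose s1 := s0 ++ [seq inr v | v <- enum D].
have us1 : uniq s1.
  rewrite cat_uniq /= map_inj_uniq ?enum_uniq ?andbT; last by move=> ? ? [].
  by apply/hasPn => k /mapP[v _ ->].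
have mcap s : measurable (\bigcap_(k in [set` s]) event k).
  by apply: fin_bigcap_measurable => // k _.
(* [N] is the failure of every exploration from [D]; outside [N], the event [B] yields generation
   [n.+1]. *)
pose N := \bigcap_(k in [set` s1]) event k.
pose B := \bigcap_(k in [set` s0]) event k.
have prB : pr P B = a * b by rewrite /B pr_events // !big_cons big_nil mulr1.
have prN : pr P N <= a * b * (1 - e) ^+ #|D|.
  rewrite /N pr_events // big_cat /= !big_cons big_nil mulr1 -/a -/b.
  rewrite ler_wpM2l ?mulr_ge0 ?pr_ge0 // big_map big_enum /=.
  rewrite -prodr_const; apply: ler_prod => v _.
  by rewrite pr_ge0 /= prC // lerD2l lerN2.
have sub : B `<=` N `|` ((fun w => (local_labels x w, local_alive x w)) @^-1` [set (c, D)] `&`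
        explores n.+1 x f).
  move=> w Bw; have /= lw := Bw (inl true) isT; have /= aw := Bw (inl false) isT.
  have [Nw|Nw] := pselect (N w); [by left | right].
  split; first by rewrite /preimage /= lw aw.
  split; first by rewrite lw.
  apply: contrapT => nex; apply: Nw => k /=.
  rewrite mem_cat => /orP[ks|/mapP[v vD ->] /= ew]; first exact: Bw.
  by apply: nex; exists v; rewrite aw lw -mem_enum.
set Z := _ `&` _ in sub *.
have mZ : measurable Z.
  apply: measurableI => //.
  rewrite [X in measurable X](_ : _ =
    local_labels x @^-1` [set c] `&` local_alive x @^-1` [set D]).
    exact: measurableI.
  by apply/seteqP; split=> w /=; [case=> -> -> | case=> -> ->].
have h1 : pr P B <= pr P N + pr P Z.
  apply: (@le_trans _ _ (pr P (N `|` Z))); last first.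
    by apply: prU_le => //; exact: mcap.
  apply: le_pr => //; first by apply: mcap.
  by apply: measurableU => //; exact: mcap.
have h2 := expr_onem_le #|D| e01.
have ab0 : 0 <= a * b by rewrite mulr_ge0 ?pr_ge0.
rewrite prB in h1; move: (ler_wpM2l ab0 h2) => h3.
rewrite -lerBlDl in h1; apply: le_trans h1.
apply: (@le_trans _ _ (a * b - a * b * (1 - e) ^+ #|D|)); last by rewrite lerD2l lerN2.
rewrite lerBrDr addrC -lerBrDr; apply: le_trans h3 _; rewrite le_eqVlt.
by apply/orP; left; apply/eqP; ring.
Qed.

End OneStep.

(** By tail sums, the first factor is the mean of the minimum of [eta] and [K]. *)
Definition mean_alive : R :=
  (\sum_(i < K) pr P0 [set w0 | (i < eta w0)%N]) * \sum_(m < L) p ^+ m.+1.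

Lemma pr_alive_mem x v :
  pr P [set w | (v.1 < fm_eta M x w)%N && alive (fm_life M x v.1 w) v.2.+1] =
  pr P0 [set w0 | (v.1 < eta w0)%N] * p ^+ v.2.+1.
Proof.
have cT : cylinder (@fm_sigma _ _ _ _ _ _ _ M) [set j | site j \in [::]] setT.
  by exists [::], (fun=> setT); split=> //; rewrite bigcap_seq big_nil.
have [_] := cyl_first_step v.1 v.2.+1 (negbT (in_nil x)) cT.
rewrite prT mul1r /pr (prob_etaE M x [set k | (v.1 < k)%N]) => <-.
congr (fine (P _)); apply/seteqP; split=> w /=; first by move=> /andP[].
by move=> [[_ ->]].
Qed.

Lemma expected_alive x :
  \sum_D pr P (local_alive x @^-1` [set D]) * #|D|%:R = mean_alive.
Proof.
pose A v := [set w | (v.1 < fm_eta M x w)%N && alive (fm_life M x v.1 w) v.2.+1].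
have mA v : measurable (A v) by exact: m_block (@sigma_alive_mem x v).
transitivity (\sum_v pr P (A v)); last first.
  under eq_bigr do rewrite pr_alive_mem.
  rewrite /mean_alive big_distrlr /= pair_bigA /=.
  by apply: eq_bigr => -[].
under [RHS]eq_bigr => v _ do rewrite (pr_total P (m_alive x) (mA v)).
rewrite exchange_big /=; apply: eq_bigr => D _.
rewrite -sum1_card natr_sum mulr_sumr big_mkcond /=; apply: eq_bigr => v _.
case: ifPn => vD.
  rewrite mulr1; congr (pr P _); apply/seteqP; split=> w /=; last by case.
  by move=> e; split=> //; move: vD; rewrite -e inE.
rewrite (_ : _ `&` _ = set0) ?pr0 //; apply/seteqP; split=> // w [/= e Aw].
by move: vD; rewrite -e inE; move: Aw => /= ->.
Qed.

Local Notation q := (d.+1%:R^-1 : R).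

Lemma pr_label x i m l : pr P (lab x i m @^-1` [set l]) = q.
Proof. by rewrite /pr lm_label_law. Qed.

Lemma m_label x i m l : measurable (lab x i m @^-1` [set l]).
Proof. exact: mF (lm_sigma_label M x i m l). Qed.

Lemma m_label_eq x i m i' m' : measurable [set w | lab x i m w = lab x i' m' w].
Proof.
rewrite [X in measurable X](_ : _ = [set w | exists l, lab x i m w = l /\ lab x i' m' w = l]).
  by apply: measurable_ex => l; apply: measurable_and2; exact: m_label.
by apply/seteqP; split=> w /=; [move=> e; exists (lab x i' m' w) | case=> l [-> ->]].
Qed.

Lemma pr_label_eq x i m i' m' : (i, m) != (i', m') ->
  pr P [set w | lab x i m w = lab x i' m' w] = q.
Proof.
move=> ne; rewrite (pr_total P (m_label x i m) (m_label_eq x i m i' m')).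
have h l : pr P (lab x i m @^-1` [set l] `&` [set w | lab x i m w = lab x i' m' w]) = q * q.
  pose j : E := inr (inr (x, i, m)); pose j' : E := inr (inr (x, i', m')).
  have jj' : j != j' by apply: contra ne => /eqP[-> ->].
  pose A (e : E) := if e == j then lab x i m @^-1` [set l] else lab x i' m' @^-1` [set l].
  have := @pr_independent _ _ _ P _ F [:: j; j'] A (@lm_independent _ _ _ _ _ _ _ M) mF.
  rewrite /= inE jj' /= => /(_ isT); rewrite bigcap_seq !big_cons !big_nil setIT mulr1.
  rewrite /A eqxx eq_sym (negPf jj') !pr_label => <-.
    congr (pr P _); apply/seteqP; split=> w /= [-> ->] //.
  move=> e; rewrite !inE => /orP[/eqP->|/eqP->]; rewrite ?eqxx.
    exact: lm_sigma_label.
  by rewrite eq_sym (negPf jj'); exact: lm_sigma_label.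
under eq_bigr do rewrite h.
by rewrite sumr_const card_ord -[LHS]mulr_natr -mulrA mulVf ?mulr1 // pnatr_eq0.
Qed.

Local Notation N := (K * L.+1)%N.

(** A union bound: [N * N] counts pairs of labels that may coincide, [N * 2] the coincidences of a
    label with [f] or with the edge to the parent, each of probability [q]. *)
Lemma pr_good x f : 1 - (N * N + N * 2)%:R * q <=
  pr P [set w | good_labels x f (local_labels x w)].
Proof.
have q0 : 0 <= q by rewrite invr_ge0.
have mgood : measurable [set w | good_labels x f (local_labels x w)].
  rewrite [X in measurable X](_ : _ = [set w | exists c, good_labels x f c /\
      local_labels x w = c]).
    apply: measurable_ex => c; apply: measurable_and2; first exact: measurable_prop.
    exact: m_labels.
  by apply/seteqP; split=> w /=; [exists (local_labels x w) | case=> c [? ->]].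
pose B1 (u : 'I_K * 'I_L.+1) : set (fm_space M) := lab x u.1 u.2 @^-1` [set f] `|`
   (if ohead (sval x) is Some l then lab x u.1 u.2 @^-1` [set l] else set0).
pose B2 (uv : ('I_K * 'I_L.+1) * ('I_K * 'I_L.+1)) : set (fm_space M) := if uv.1 != uv.2 then
  [set w | lab x uv.1.1 uv.1.2 w = lab x uv.2.1 uv.2.2 w] else set0.
have mB1 u : measurable (B1 u).
  apply: measurableU; first exact: m_label.
  by case: (ohead _) => // l; exact: m_label.
have mB2 uv : measurable (B2 uv).
  by rewrite /B2; case: ifP => // _; exact: m_label_eq.
have sub : ~` [set w | good_labels x f (local_labels x w)] `<=`
    \big[setU/set0]_u B1 u `|` \big[setU/set0]_uv B2 uv.
  move=> w /= /negP; rewrite negb_and => /orP[/injectivePn[u [u2 uv e]]|].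
    right; rewrite -bigcup_seq; exists (u, u2); first by rewrite /= mem_index_enum.
    by rewrite /B2 /= uv /=; move: e; rewrite !ffunE.
  rewrite negb_forall => /existsP[u]; rewrite negb_and !negbK ffunE => h.
  left; rewrite -bigcup_seq; exists u; first by rewrite /= mem_index_enum.
  case/orP: h => /eqP h; first by left.
  by right; rewrite h.
rewrite -[X in _ <= pr P X]setCK prC; last exact: measurableC.
rewrite lerD2l lerN2; apply: le_trans (le_pr P _ _ sub) _.
- exact: measurableC.
- by apply: measurableU; apply: bigsetU_measurable.
apply: le_trans (prU_le P _ _) _; try exact: bigsetU_measurable.
rewrite natrD mulrDl addrC; apply: lerD.
  apply: le_trans (pr_bigU_le P _ mB2) _.
  apply: (@le_trans _ _ (\sum_(uv : ('I_K * 'I_L.+1) * ('I_K * 'I_L.+1)) q)).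
    apply: ler_sum => -[u u2] _; rewrite /B2 /=; case: ifPn => [uv|_]; last by rewrite pr0.
    by rewrite pr_label_eq.
  by rewrite sumr_const !card_prod !card_ord -[leLHS]mulr_natl.
apply: le_trans (pr_bigU_le P _ mB1) _.
apply: (@le_trans _ _ (\sum_(u : 'I_K * 'I_L.+1) (2%:R * q))).
  apply: ler_sum => u _; rewrite mulr_natl mulr2n.
  apply: le_trans (prU_le P _ _) _; first exact: m_label.
    by case: (ohead _) => // l; exact: m_label.
  rewrite pr_label lerD2l; case: (ohead _) => [l|]; first by rewrite pr_label.
  by rewrite pr0.
by rewrite sumr_const !card_prod !card_ord -[leLHS]mulr_natl (natrM _ N 2) mulrA.
Qed.

(** The last hypothesis says that [e] is preserved from one generation to the next: it bounds the
    average of [one_step_bound] over [c] and [D], which factorizes, with [#|D|] replaced by [K * L]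
    in the quadratic term. *)
Lemma explores_ge (e : R) : 0 <= e <= 1 ->
  0 <= e * mean_alive - ((K * L)%:R * e) ^+ 2 ->
  e <= (1 - (N * N + N * 2)%:R * q) * (e * mean_alive - ((K * L)%:R * e) ^+ 2) ->
  forall n x f, e <= pr P (explores n x f).
Proof.
move=> e01 g0 he; elim=> [|n IH] x f.
  rewrite (_ : explores 0 x f = setT) ?prT; first by case/andP: e01.
  by apply/seteqP; split.
pose X w := (local_labels x w, local_alive x w).
have mX cD : measurable (X @^-1` [set cD]).
  case: cD => c D; rewrite [X in measurable X](_ : _ =
    local_labels x @^-1` [set c] `&` local_alive x @^-1` [set D]).
    exact: measurableI.
  by apply/seteqP; split=> w; rewrite /X /=; [case=> -> -> | case=> -> ->].
have mlab : measurable [set w | good_labels x f (local_labels x w)].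
  rewrite [X in measurable X](_ : _ = [set w | exists c, good_labels x f c /\
      local_labels x w = c]).
    apply: measurable_ex => c; apply: measurable_and2; first exact: measurable_prop.
    exact: m_labels.
  by apply/seteqP; split=> w /=; [exists (local_labels x w) | case=> c [? ->]].
rewrite (pr_total P mX (m_explores n.+1 x f)); apply: le_trans he _.
apply: le_trans (ler_wpM2r g0 (pr_good x f)) _.
have -> : pr P [set w | good_labels x f (local_labels x w)] =
    \sum_c (if good_labels x f c then pr P (local_labels x @^-1` [set c]) else 0).
  rewrite (pr_total P (m_labels x) mlab); apply: eq_bigr => c _.
  case: ifPn => g.
    congr (pr P _); apply/seteqP; split=> w /=; first by case.
    by move=> ->.
  rewrite (_ : _ `&` _ = set0) ?pr0 //; apply/seteqP; split=> // w [/= -> gc].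
  by move: g; rewrite gc.
have -> : e * mean_alive - ((K * L)%:R * e) ^+ 2 =
    \sum_D pr P (local_alive x @^-1` [set D]) * (#|D|%:R * e - ((K * L)%:R * e) ^+ 2).
  under eq_bigr do rewrite mulrBr mulrA.
  rewrite sumrB -!mulr_suml expected_alive mulrC; congr (_ - _).
  have := pr_total P (m_alive x) measurableT.
  by under eq_bigr do rewrite setIT; rewrite prT => <-; rewrite mul1r.
rewrite big_distrlr /= pair_bigA /=; apply: ler_sum => -[c D] _ /=.
case: ifPn => g; last by rewrite mul0r pr_ge0.
apply: le_trans (one_step_bound g D e01 IH).
rewrite mulrA ler_wpM2l ?mulr_ge0 ?pr_ge0 // lerD2l lerN2.
have Dle : (#|D| <= K * L)%N.
  by rewrite -[K in (K * _)%N]card_ord -[L in (_ * L)%N]card_ord -card_prod max_card.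
have e0 : 0 <= e by case/andP: e01.
by rewrite lerXn2r ?nnegrE ?mulr_ge0 // ler_wpM2r // ler_nat.
Qed.

Lemma size_walk x i m w : (size (sval (fm_walk M x i m w)) <= size (sval x) + m)%N.
Proof.
elim: m => [|m IH]; first by rewrite lm_walk0 addn0.
rewrite lm_walkS; case: (size_toggle (lab x i m w) (fm_walk M x i m w)) => h.
  by rewrite h addnS ltnS.
by rewrite addnS; apply: leq_trans (leq_trans IH (leqnSn _)); rewrite -h.
Qed.

Lemma size_le_active w x T : active_at w x T -> (size (sval x) <= T)%N.
Proof.
have [b Tb] := ubnP T; elim: b => // b IH in x T Tb *.
move=> /last_hop[[-> ->]//|[y [T' [m [yT yx [i [_ _ wi]] e]]]]].
rewrite -wi e; apply: leq_trans (size_walk _ _ _ _) _; rewrite leq_add2r.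
have st : proper_start w by move=> ? ?; exact: lm_walk0.
apply: IH yT; rewrite -ltnS; apply: leq_trans Tb; rewrite ltnS e.
case: m wi e => [|m] wi e; last by rewrite addnS ltnS leq_addr.
by move: yx; rewrite -wi lm_walk0 eqxx.
Qed.

Lemma explores_far w n x f T : explores n x f w -> active_at w x T ->
  exists y T', active_at w y T' /\ (size (sval x) + n <= size (sval y))%N.
Proof.
elim: n x f T => [|n IH] x f T /=.
  by move=> _ xT; exists x, T; rewrite addn0.
move=> [g [v [va ex]]] xT.
have h : hop w x (ray_site x (local_labels x w) v) v.2.+1.
  exists v.1; split; last by rewrite ray_site_walk.
    by move: va; rewrite inE => /andP[].
  by move: va; rewrite inE => /andP[].
have [T' _ yT'] := active_hop xT h.
have [z [T'' [zT sz]]] := IH _ _ _ ex yT'.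
exists z, T''; split=> //; apply: leq_trans sz.
by rewrite (size_ray_site g) -addnA leq_add2l addSn ltnS leq_addl.
Qed.

(** Particles cross one edge per unit of time, so a site found at depth at least [n] is activated no
    earlier than [n], and [active_before] gives active particles at all times below [n]. These
    events decrease to survival, and the bound [e] passes to the limit. *)
Lemma survival_pos (e : R) : 0 < e <= 1 ->
  0 <= e * mean_alive - ((K * L)%:R * e) ^+ 2 ->
  e <= (1 - (N * N + N * 2)%:R * q) * (e * mean_alive - ((K * L)%:R * e) ^+ 2) ->
  (0 < P (survival M))%E.
Proof.
move=> /andP[e0 e1] g0 he.
have e01 : 0 <= e <= 1 by rewrite (ltW e0) e1.
have st w : proper_start w by move=> ? ?; exact: lm_walk0.
pose U n : set (fm_space M) :=
  [set w | forall t, (t < n)%N -> exists x i, particle_active w t x i].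
have mt t : measurable [set w : fm_space M | exists x i, particle_active w t x i].
  apply: measurable_ex => x; apply: measurable_ex => i.
  exact: measurable_particle_active.
have mU n : measurable (U n).
  apply: measurable_all => t; have [tn|nt] := boolP (t < n)%N.
    rewrite [X in measurable X](_ : _ = [set w | exists x i, particle_active w t x i]) //.
    by apply/seteqP; split=> w /=; [apply | move=> ?].
  by rewrite [X in measurable X](_ : _ = setT) //; apply/seteqP; split.
have Ue n : (e%:E <= P (U n))%E.
  rewrite (prE P (mU n)) lee_fin.
  apply: le_trans (explores_ge e01 g0 he n (@root G) ord0) _.
  apply: le_pr => // w ew t tn.
  have [y [T' [yT sy]]] := explores_far ew (active_root w).
  apply: (active_before (st w) yT); apply: leq_trans tn _.
  exact: leq_trans sy (size_le_active yT).
have -> : survival M = \bigcap_n U n.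
  apply/seteqP; split=> w h; first by move=> n _ t _; exact: h.
  by move=> t; exact: (h t.+1 I t (ltnSn t)).
apply: (@lt_le_trans _ _ e%:E); first by rewrite lte_fin.
have cv : (P \o U) n @[n --> \oo] --> P (\bigcap_n U n).
  apply: nonincreasing_cvg_mu => //.
  - by rewrite -ge0_fin_numE ?fin_num_measure.
  - exact: bigcap_measurable.
  - by move=> m n mn; apply/subsetPset => w h t tm; apply: h; exact: leq_trans tm mn.
rewrite -(cvg_lim _ cv) //; apply: lime_ge; first by apply/cvg_ex; eexists; exact: cv.
exact: nearW.
Qed.

End Survival.

(** * The critical parameter *)

Section CriticalParameter.
Variables (R : realType) (d0 : measure_display) (T0 : measurableType d0).
Variables (P0 : probability T0 R) (eta : {RV P0 >-> nat}) (a : R).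
Hypothesis Ea : ('E_P0[fun u => (eta u)%:R : R] = a%:E)%E.

Definition survival_parameters (G : rooted_graph) : set R :=
  [set p : R | 0 <= p <= 1 /\
    exists M : frog_model G p eta, (0 < fm_prob M (survival M))%E].

Lemma mean_ge0 : 0 <= a.
Proof. by rewrite -lee_fin -Ea; apply: expectation_ge0 => u; exact: ler0n. Qed.

(** The infimum of an empty set of reals is a default value, hence the nonemptiness hypothesis. *)
Lemma p_c_ge (G : rooted_graph) : survival_parameters G !=set0 ->
  1 / (1 + a) <= p_c G eta.
Proof.
move=> ne; apply: lb_le_inf => // p [p01 [M sM]].
have a1 : 0 < 1 + a by rewrite ltr_wpDr // mean_ge0.
rewrite ler_pdivrMr // leNgt; apply/negP => sub.
by move: sM; rewrite (survival_null M p01 Ea sub) ltxx.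
Qed.

Lemma p_c_le (G : rooted_graph) p : survival_parameters G p -> p_c G eta <= p.
Proof. by apply: ge_inf; exists 0 => r [/andP[]]. Qed.

Lemma cvg_tail_sum :
  (\sum_(i < n) pr P0 [set u | (i < eta u)%N]) @[n --> \oo] --> a.
Proof.
have m i : measurable [set u | (i < eta u)%N].
  rewrite -[X in measurable X]setTI.
  exact: (measurable_funPT eta measurableT [set k | (i < k)%N]).
have cv : (\sum_(0 <= i < n) P0 [set u | (i < eta u)%N])%E @[n --> \oo] --> a%:E.
  by rewrite -Ea expectation_nat; apply: is_cvg_nneseries.
have -> : (fun n => \sum_(i < n) pr P0 [set u | (i < eta u)%N]) =
    fine \o (fun n => \sum_(0 <= i < n) P0 [set u | (i < eta u)%N])%E.
  apply/funext => n /=; rewrite big_mkord -sum_fine // => i _.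
  exact: fin_num_measure.
exact: fine_cvg cv.
Qed.

Lemma cvg_geometric_sum (p : R) : 0 <= p < 1 ->
  (\sum_(m < n) p ^+ m.+1) @[n --> \oo] --> p / (1 - p).
Proof.
move=> /andP[p0 p1]; have p1' : 1 - p != 0 by rewrite subr_eq0 eq_sym lt_eqF.
have -> : (fun n => \sum_(m < n) p ^+ m.+1) = (fun n => p / (1 - p) * (1 - p ^+ n)).
  apply/funext => n; rewrite -geometric_partial_sum big_mkord mulr_sumr.
  by apply: eq_bigr => m _; rewrite mulrA divfK // exprS.
have : p / (1 - p) * (1 - p ^+ n) @[n --> \oo] --> p / (1 - p) * (1 - 0).
  apply: cvgMr; apply: cvgB; first exact: cvg_cst.
  by apply: cvg_expr; rewrite ger0_norm.
by rewrite subr0 mulr1.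
Qed.

(** With [K = L = n] the mean tends to [a * (p / (1 - p))], which exceeds 1 exactly when
    [p * (1 + a) > 1]. *)
Lemma mean_alive_gt1 p : 1 / (1 + a) < p < 1 ->
  exists n, 1 < mean_alive p eta n n.
Proof.
move=> /andP[pl p1]; have a0 := mean_ge0.
have a1 : 0 < 1 + a by rewrite ltr_wpDr.
have p0 : 0 < p by apply: le_lt_trans pl; rewrite divr_ge0 // ltW.
have p1' : 0 < 1 - p by rewrite subr_gt0.
have cv : mean_alive p eta n n @[n --> \oo] --> a * (p / (1 - p)).
  by apply: cvgM; [exact: cvg_tail_sum | apply: cvg_geometric_sum; rewrite ltW].
have gt1 : 1 < a * (p / (1 - p)).
  rewrite mulrA ltr_pdivlMr // mul1r; move: pl; rewrite ltr_pdivrMr //; lra.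
have : \forall n \near \oo, 1 < mean_alive p eta n n by exact: cvgr_gt cv _ gt1.
by move=> [n _ /(_ n (leqnn n))]; exists n.
Qed.

Lemma near_survival_parameters p : 1 / (1 + a) < p < 1 ->
  \forall d \near \oo, survival_parameters (regular_tree d.+1) p.
Proof.
move=> pl; have [K mu1] := mean_alive_gt1 pl.
have [p0 p1] : 0 < p /\ p < 1.
  move: pl => /andP[pl ->]; split=> //; apply: le_lt_trans pl.
  by rewrite divr_ge0 // addr_ge0 // mean_ge0.
(* Half of the surplus [mu - 1] pays for the quadratic error, leaving [mu - B * e >= 1 + h]; the
   other half pays for bad labels, through [1 - C / d.+1%:R >= (1 + h)^-1]. The product of the two
   factors is then at least 1. *)
set mu := mean_alive p eta K K in mu1; pose h := (mu - 1) / 2.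
have h0 : 0 < h by rewrite divr_gt0 // subr_gt0.
pose B : R := (K * K)%:R ^+ 2; pose N := (K * K.+1)%N.
pose C : R := (N * N + N * 2)%:R.
have B0 : 0 <= B by exact: exprn_ge0.
have C0 : 0 <= C by exact: ler0n.
pose e := Num.min 1 (h / (B + 1)).
have B1 : 0 < B + 1 by rewrite ltr_wpDl.
have C1 : 0 < C + 1 by rewrite ltr_wpDl.
have e0 : 0 < e by rewrite lt_min ltr01 divr_gt0.
have e1 : e <= 1 by rewrite ge_min lexx.
have Be : B * e <= h.
  have : e <= h / (B + 1) by rewrite ge_min lexx orbT.
  rewrite ler_pdivlMr // mulrC; apply: le_trans.
  by rewrite mulrDl lerDl mul1r ltW.
have h1 : 0 < h / (1 + h) / (C + 1) by do 2 apply: divr_gt0 => //; apply: addr_gt0.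
have eE : e * mu - ((K * K)%:R * e) ^+ 2 = e * (mu - B * e).
  by rewrite exprMn -/B; ring.
near=> d.
have q_lt : d.+1%:R^-1 < h / (1 + h) / (C + 1).
  near: d; exact: (near_infty_natSinv_lt (PosNum h1)).
have q0 : 0 <= d.+1%:R^-1 :> R by rewrite invr_ge0.
split; first by rewrite !ltW.
have p01 : 0 <= p < 1 by rewrite ltW.
have [M] := labelled_model_exists d eta p01.
exists M; apply: (@survival_pos _ _ _ _ _ _ _ M K K e).
- by rewrite e0.
- rewrite eE mulr_ge0 ?(ltW e0) // subr_ge0; apply: le_trans Be _; rewrite /h; lra.
rewrite -/mu eE mulrCA -/N -/C.
rewrite ler_pMr //.
have Cq : C / d.+1%:R <= h / (1 + h).
  move: q_lt; rewrite ltr_pdivlMr // => /ltW; apply: le_trans.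
  by rewrite mulrC ler_wpM2l // lerDl.
have hh : 1 - h / (1 + h) = (1 + h)^-1.
  have h1' : 1 + h != 0 by rewrite gt_eqF // addr_gt0.
  by rewrite -[X in X - _](divff h1') -mulrBl addrK mul1r.
apply: (@le_trans _ _ ((1 + h)^-1 * (1 + h))).
  by rewrite mulVf // gt_eqF // addr_gt0.
apply: ler_pM.
- by rewrite invr_ge0 addr_ge0 // ltW.
- by rewrite addr_ge0 // ltW.
- by rewrite -hh lerD2l lerN2.
- rewrite /h in Be *; lra.
Unshelve. all: by end_near. Qed.

End CriticalParameter.

Theorem theorem1p7 (R : realType) (d0 : measure_display)
    (T0 : measurableType d0) (P0 : probability T0 R) (eta : {RV P0 >-> nat})
    (eta_pos : (0 < P0 [set w | (1 <= eta w)%N])%E)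
    (eta_mean : ('E_P0[fun w => ((eta w)%:R : R)] < +oo)%E) :
  p_c (regular_tree d) eta @[d --> \oo] -->
    1 / (1 + fine 'E_P0[fun w => ((eta w)%:R : R)]).
Proof.
set m := expectation.body _ _ in eta_mean *.
have m0 : (0 <= m)%E by apply: expectation_ge0 => w; exact: ler0n.
have Em : m = (fine m)%:E by rewrite fineK // ge0_fin_numE.
(* The first term of the tail sum is the probability of [1 <= eta]. A positive mean gives [l < 1],
   which leaves room for parameters strictly between [l] and 1. *)
have mpos : 0 < fine m.
  rewrite -lte_fin -Em; apply: lt_le_trans eta_pos _.
  rewrite /m expectation_nat nneseries_recl //.
  by rewrite leeDl // nneseries_ge0.
set l := 1 / _; have l1 : l < 1.
  by rewrite ltr_pdivrMr ?mul1r ?ltrDl // addr_gt0.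
rewrite -cvg_shiftS; apply/cvgrPdist_le => e e0.
(* The midpoint of [l] and 1 keeps [p] below 1, so that lifetimes are finite. *)
pose p := Num.min (l + e) ((l + 1) / 2).
have pl : l < p < 1.
  by rewrite lt_min gt_min ltrDl e0 /= [X in _ || X](_ : _ = true) ?orbT ?andbT; lra.
have pe : p <= l + e by rewrite ge_min lexx.
have nsp := near_survival_parameters Em pl.
near=> d.
have sp : survival_parameters eta (regular_tree d.+1) p.
  by near: d; exact: nsp.
(* The parameter from the upper bound also provides the nonemptiness required by the lower bound. *)
have lo : l <= p_c (regular_tree d.+1) eta by apply: (p_c_ge Em); exists p.
have up := p_c_le sp.
rewrite distrC ger0_norm ?subr_ge0 // lerBlDl; exact: le_trans up pe.
Unshelve. all: by end_near. Qed.
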